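(* Let $A$ be a discrete $p$-primary abelian group endowed with the trivial $G$-action, and let $\vartheta:\Gamma\to\mathbb{Z}_p^\times$ be a continuous character with $\vartheta|_\Delta=\omega_\Delta^m$ for some $m\in\mathbb{Z}/(p-1)\mathbb{Z}$. Then $$R\Gamma(G,A(\vartheta))\simeq R\Gamma\bigl(\Gamma_1,(e_{-m}\mathbb{X}(A))\{\vartheta\}\bigr)$$ in $D^+(\mathrm{Mod}_p^{\mathrm{disc}})$. In particular, for any integer $m$, $$R\Gamma(G,A(m))\simeq R\Gamma\bigl(\Gamma_1,(e_{-m}\mathbb{X}(A))\{m\}\bigr).$$ Here the twisted complexes on the right are viewed as objects of $D^+(\mathrm{Mod}_{\Gamma_1,p}^{\mathrm{disc}})$ by restricting the twisted $\Gamma$-action along $\Gamma_1\hookrightarrow\Gamma$.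
   Context: Let $p$ be an odd prime, $S=\{p,\infty\}$, $\mathbb{Q}_S$ the maximal extension of $\mathbb{Q}$ unramified outside $S$, $G=\mathrm{Gal}(\mathbb{Q}_S/\mathbb{Q})$, $F_\infty=\mathbb{Q}(\mu_{p^\infty})=\bigcup_n\mathbb{Q}(\mu_{p^n})$, $H=\mathrm{Gal}(\mathbb{Q}_S/F_\infty)$, and $\Gamma=G/H=\mathrm{Gal}(F_\infty/\mathbb{Q})$. Let $\chi_\Gamma:\Gamma\xrightarrow{\sim}\mathbb{Z}_p^\times$ be the isomorphism induced by the cyclotomic character. Since $\mathbb{Z}_p^\times=\mu_{p-1}\times(1+p\mathbb{Z}_p)$, one has $\Gamma=\Delta\times\Gamma_1$, where $\Delta$ and $\Gamma_1$ correspond under $\chi_\Gamma$ to $\mu_{p-1}$ and $1+p\mathbb{Z}_p$. Let $\omega_\Delta=\chi_\Gamma|_\Delta:\Delta\to\mu_{p-1}\subset\mathbb{Z}_p^\times$ (the Teichmüller character restricted to $\Delta$). For a profinite group $K$, $\mathrm{Mod}_{K,p}^{\mathrm{disc}}$ is the abelian category of discrete $p$-primary abelian groups with continuous $K$-action, and $D^+(\mathrm{Mod}_{K,p}^{\mathrm{disc}})$ is its bounded-below derived $\infty$-category (realized by bounded-below complexes of injectives); for $K=1$ write $\mathrm{Mod}_p^{\mathrm{disc}}$. For a closed normal subgroup $K'$ of $K$, $R\Gamma(K',-):D^+(\mathrm{Mod}_{K,p}^{\mathrm{disc}})\to D^+(\mathrm{Mod}_{K/K',p}^{\mathrm{disc}})$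 is the right derived functor of $K'$-invariants. Twists: for a continuous character $\vartheta:\Gamma\to\mathbb{Z}_p^\times$ and $M\in\mathrm{Mod}_{\Gamma,p}^{\mathrm{disc}}$, $M\{\vartheta\}$ is the same abelian group with $\delta\in\Gamma$ acting by $\vartheta(\delta)$ times its original action. For $M\in\mathrm{Mod}_{G,p}^{\mathrm{disc}}$, $M(\vartheta)$ is the same abelian group with $g\in G$ acting by $\vartheta(\bar g)$ times its original action, $\bar g$ being the image of $g$ in $\Gamma$. These are exact autoequivalences and extend degreewise to the derived $\infty$-categories. For an integer $m$, $(m):=(\chi_\Gamma^m)$ and $\{m\}:=\{\chi_\Gamma^m\}$. The universal cyclotomic complex is $\mathbb{X}(A):=R\Gamma(H,A)\in D^+(\mathrm{Mod}_{\Gamma,p}^{\mathrm{disc}})$. For $j\in\mathbb{Z}/(p-1)\mathbb{Z}$ put $e_j=\frac{1}{p-1}\sum_{\delta\in\Delta}\omega_\Delta^{-j}(\delta)[\delta]\in\mathbb{Z}_p[\Delta]$. The functor $M\mapsto e_jM$ is an exact endofunctor of $\mathrm{Mod}_{\Gamma,p}^{\mathrm{disc}}$ preserving injectives, and extends degreewise to an exact endofunctor $e_j$ of $D^+(\mathrm{Mod}_{\Gamma,p}^{\mathrm{disc}})$. *)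

(* Defs.v *)
From HB Require Import structures.
From mathcomp Require Import all_boot all_order all_algebra all_field.
From mathcomp Require Import all_classical.
From mathcomp Require Import topology.
From mathcomp Require Import ring finmap.

Set Implicit Arguments.
Unset Strict Implicit.
Unset Printing Implicit Defensive.

Import GRing.Theory.
Local Open Scope classical_set_scope.
Local Open Scope ring_scope.

(* Z_p is the inverse limit of the rings Z/p^n: the n-th term of a coherent
   sequence is its residue modulo p^n, a natural number smaller than p^n.  The
   proof of primality is only there to make the ring structure inferable. *)
Definition coherent (p : nat) (u : nat -> nat) : bool :=
  `[< forall n, (u n.+1 %% p ^ n = u n)%N >].

Record padic_int (p : nat) (pr : prime p) : Type :=
  Padic { padic_seq : nat -> nat; padic_seqP : coherent p padic_seq }.

HB.instance Definition _ p (pr : prime p) := [isSub for @padic_seq p pr].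
HB.instance Definition _ p (pr : prime p) := [Choice of padic_int pr by <:].

Section PadicIntegers.
Variables (p : nat) (pr : prime p).
Local Notation Zp := (padic_int pr).

Definition residue (u : Zp) (n : nat) : nat := val u n.

Implicit Types u v w : Zp.

Lemma residueS u n : (residue u n.+1 %% p ^ n = residue u n)%N.
Proof. by move: n; apply/asboolP; exact: (valP u). Qed.

Lemma residue_mod u n : (residue u n %% p ^ n = residue u n)%N.
Proof. by rewrite -residueS modn_mod. Qed.

Lemma residue_modD u n k : (residue u (k + n) %% p ^ n = residue u n)%N.
Proof.
elim: k => [|k IH]; first by rewrite residue_mod.
by rewrite -[RHS]IH -(residueS u (k + n)) addSn modn_dvdm // dvdn_exp2l // leq_addl.
Qed.

Lemma residueP u v : (forall n, residue u n = residue v n) -> u = v.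
Proof. by move=> h; apply/val_inj/funext. Qed.

Lemma coherent_mod (f : nat -> nat) :
    (forall n, f n.+1 = f n %[mod p ^ n]) ->
  coherent p (fun n => f n %% p ^ n)%N.
Proof.
move=> h; apply/asboolP => n /=.
by rewrite modn_dvdm ?dvdn_exp2l // h.
Qed.

Definition padic_of f (h : forall n, f n.+1 = f n %[mod p ^ n]) : Zp :=
  Padic pr (coherent_mod h).

Lemma residue_of f h n : residue (@padic_of f h) n = (f n %% p ^ n)%N.
Proof. by []. Qed.

Let compat0 n : (0 = 0 %[mod p ^ n])%N. Proof. by []. Qed.
Let compat1 n : (1 = 1 %[mod p ^ n])%N. Proof. by []. Qed.
Let compatD u v n :
  (residue u n.+1 + residue v n.+1 = residue u n + residue v n %[mod p ^ n])%N.
Proof. by rewrite -modnDm !residueS. Qed.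
Let compatM u v n :
  (residue u n.+1 * residue v n.+1 = residue u n * residue v n %[mod p ^ n])%N.
Proof. by rewrite -modnMm !residueS. Qed.
Let compatN u n :
  (p ^ n.+1 - residue u n.+1 = p ^ n - residue u n %[mod p ^ n])%N.
Proof.
have lt k : (residue u k <= p ^ k)%N.
  by rewrite -residue_mod ltnW // ltn_mod expn_gt0 prime_gt0.
apply/eqP; rewrite -(eqn_modDr (residue u n.+1)) subnK //.
by rewrite -modnDmr residueS subnK // modnn expnS modnMl.
Qed.

Definition padic_zero := padic_of compat0.
Definition padic_one := padic_of compat1.
Definition padic_add u v := padic_of (compatD u v).
Definition padic_opp u := padic_of (compatN u).
Definition padic_mul u v := padic_of (compatM u v).

Fact padic_addA : associative padic_add.
Proof.
by move=> u v w; apply: residueP => n; rewrite !residue_of modnDml modnDmr addnA.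
Qed.
Fact padic_addC : commutative padic_add.
Proof. by move=> u v; apply: residueP => n; rewrite !residue_of addnC. Qed.
Fact padic_add0 : left_id padic_zero padic_add.
Proof.
by move=> u; apply: residueP => n; rewrite !residue_of mod0n add0n residue_mod.
Qed.
Fact padic_addN : left_inverse padic_zero padic_opp padic_add.
Proof.
move=> u; apply: residueP => n; rewrite !residue_of modnDml subnK ?modnn ?mod0n//.
by rewrite -residue_mod ltnW // ltn_mod expn_gt0 prime_gt0.
Qed.

HB.instance Definition _ :=
  GRing.isZmodule.Build Zp padic_addA padic_addC padic_add0 padic_addN.

Fact padic_mulA : associative padic_mul.
Proof.
by move=> u v w; apply: residueP => n; rewrite !residue_of modnMml modnMmr mulnA.
Qed.
Fact padic_mulC : commutative padic_mul.
Proof. by move=> u v; apply: residueP => n; rewrite !residue_of mulnC. Qed.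
Fact padic_mul1 : left_id padic_one padic_mul.
Proof.
by move=> u; apply: residueP => n; rewrite !residue_of modnMml mul1n residue_mod.
Qed.
Fact padic_mulDl : left_distributive padic_mul padic_add.
Proof.
move=> u v w; apply: residueP => n; rewrite !residue_of modnMml mulnDl.
by rewrite modnDml modnDmr.
Qed.
Fact padic_one_neq0 : padic_one != 0.
Proof.
apply/eqP => /(congr1 (residue ^~ 1%N)); rewrite !residue_of expn1 mod0n.
by rewrite modn_small ?prime_gt1.
Qed.

HB.instance Definition _ := GRing.Zmodule_isComNzRing.Build Zp
  padic_mulA padic_mulC padic_mul1 padic_mulDl padic_one_neq0.

Definition padic_unit : {pred Zp} :=
  fun u => `[< exists v, v * u = 1 >].
Definition padic_inv u : Zp := xget u [set v | v * u = 1].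

Fact padic_mulV : {in padic_unit, left_inverse 1 padic_inv *%R}.
Proof. by move=> u /asboolP h; exact: (xgetPex u h). Qed.
Fact padic_unitP u v : v * u = 1 -> padic_unit u.
Proof. by move=> h; apply/asboolP; exists v. Qed.
Fact padic_inv_out : {in [predC padic_unit], padic_inv =1 id}.
Proof.
move=> u /asboolPn h; rewrite /padic_inv; case: xgetP => // v _ /= hv.
by case: h; exists v.
Qed.

HB.instance Definition _ := GRing.ComNzRing_hasMulInverse.Build Zp
  padic_mulV padic_unitP padic_inv_out.

HB.instance Definition _ := Topological.copy Zp
  (initial_topology (val : Zp -> prod_topology (fun _ : nat => nat))).

Lemma residueD u v n :
  residue (u + v) n = ((residue u n + residue v n) %% p ^ n)%N.
Proof. by []. Qed.
Lemma residueM u v n :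
  residue (u * v) n = ((residue u n * residue v n) %% p ^ n)%N.
Proof. by []. Qed.
Lemma residue1 n : residue 1 n = (1 %% p ^ n)%N.
Proof. by []. Qed.

End PadicIntegers.
(* All the groups below are profinite, but the categories of discrete modules
   and their functors only use the group law and the topology. *)
#[short(type="preTopGroupType")]
HB.structure Definition PreTopologicalGroup :=
  {G of Topological G & Group G}.

Fact unit_mulA : associative (fun _ _ : unit => tt). Proof. by []. Qed.
Fact unit_mul1 : left_id tt (fun _ _ : unit => tt). Proof. by case. Qed.
Fact unit_mulr1 : right_id tt (fun _ _ : unit => tt). Proof. by case. Qed.
Fact unit_mulV : left_inverse tt id (fun _ _ : unit => tt). Proof. by []. Qed.
Fact unit_mulVr : right_inverse tt id (fun _ _ : unit => tt). Proof. by []. Qed.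
HB.instance Definition _ := isGroup.Build unit
  unit_mulA unit_mul1 unit_mulr1 unit_mulV unit_mulVr.

Fact unit_openT : [set: set unit] setT. Proof. by []. Qed.
Fact unit_openI : setI_closed [set: set unit]. Proof. by []. Qed.
Fact unit_open_bigU (I : Type) (f : I -> set unit) :
  (forall i, [set: set unit] (f i)) -> [set: set unit] (\bigcup_i f i).
Proof. by []. Qed.
HB.instance Definition _ :=
  isOpenTopological.Build unit unit_openT unit_openI unit_open_bigU.

(* Characters K -> Z_p^*; the values of a monoid morphism on a group are
   automatically units. *)
Section Characters.
Variables (p : nat) (pr : prime p).
Local Notation Zp := (padic_int pr).

Record character (K : preTopGroupType) := Character {
  char_fun :> K -> Zp;
  char1 : char_fun 1%g = 1;
  charM : forall x y, char_fun (x * y)%g = char_fun x * char_fun y;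
  char_continuous : continuous char_fun
}.

HB.instance Definition _ K := gen_eqMixin (character K).
HB.instance Definition _ K := gen_choiceMixin (character K).

Section Theory.
Variable K : preTopGroupType.

Lemma continuous_residue (f : K -> Zp) : continuous f ->
  forall n a, open [set g | residue (f g) n = a].
Proof.
move=> fc n a.
have -> : [set g | residue (f g) n = a] =
    f @^-1` ((fun u : Zp => residue u n) @^-1` [set a]) by [].
move/continuousP: fc; apply.
exists (@^~ n @^-1` [set a]) => //.
have pc : continuous (fun u : prod_topology (fun _ : nat => nat) => u n : nat).
  exact: (@proj_continuous _ (fun _ : nat => nat : topologicalType) n).
by move/continuousP: pc; apply; exact: discrete_open.
Qed.

Lemma residue_continuous (f : K -> Zp) :
  (forall n a, open [set g | residue (f g) n = a]) -> continuous f.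
Proof.
move=> fo; apply: continuous_comp_initial => g; apply/cvg_sup => n.
move: g; apply: (@continuous_comp_initial _ _ _ (fun u : nat -> nat => u n)
  (fun g => padic_seq (f g))).
apply/continuousP => B _; have -> : ((fun u : nat -> nat => u n) \o
    (fun g => padic_seq (f g))) @^-1` B =
    \bigcup_(a in B) [set g | residue (f g) n = a].
  apply/seteqP; split=> [g Bg | g [a Ba /= ga]]; first by exists (residue (f g) n).
  by rewrite /= -[padic_seq _ n]/(residue (f g) n) ga.
by apply: bigcup_open => a _; exact: fo.
Qed.


Lemma residue_homo_continuous (f h : K -> Zp) : continuous f ->
    (forall n x y, residue (f x) n = residue (f y) n ->
       residue (h x) n = residue (h y) n) -> continuous h.
Proof.
move=> fc fh; apply: residue_continuous => n a.
have -> : [set g | residue (h g) n = a] =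
    \bigcup_(g0 in [set g0 | residue (h g0) n = a])
       [set g | residue (f g) n = residue (f g0) n].
  apply/seteqP; split=> [g ga | g [g0 /= <-]]; first by exists g.
  exact: fh.
by apply: bigcup_open => g0 _; exact: continuous_residue.
Qed.

Lemma char_unit (th : character K) g : th g \is a GRing.unit.
Proof.
by apply/unitrPr; exists (th g^-1%g); rewrite -charM mulgV char1.
Qed.

Fact residue_exp (u v : Zp) k n : residue u n = residue v n ->
  residue (u ^+ k) n = residue (v ^+ k) n.
Proof. by move=> uv; elim: k => // k IH; rewrite !exprS !residueM uv IH. Qed.

Fact residue_inv (u v : Zp) n : u \is a GRing.unit -> v \is a GRing.unit ->
  residue u n = residue v n -> residue u^-1 n = residue v^-1 n.
Proof.
move=> uu vu uv; rewrite -[u^-1](mulrK vu) residueM.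
have -> : residue (u^-1 * v) n = residue (1 : Zp) n.
  by rewrite -(mulVr uu) !residueM uv.
by rewrite -residueM mul1r.
Qed.

Section Exponent.
Variables (th : character K) (m : int).

Fact char_exp1 : th 1%g ^ m = 1. Proof. by rewrite char1 exp1rz. Qed.
Fact char_expM x y : th (x * y)%g ^ m = th x ^ m * th y ^ m.
Proof. by rewrite charM exprMz_comm ?char_unit //; exact: mulrC. Qed.
Fact char_exp_continuous : continuous (fun g => th g ^ m).
Proof.
apply: (residue_homo_continuous (@char_continuous _ th)) => n x y xy.
case: m => k; first exact: residue_exp.
by rewrite !NegzE -!exprnN; apply: residue_inv; rewrite ?unitrX ?char_unit //;
  apply: residue_exp.
Qed.
Definition char_exp : character K :=
  Character char_exp1 char_expM char_exp_continuous.
End Exponent.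

Fact char_triv_continuous : continuous (fun _ : K => 1 : Zp).
Proof. by move=> g; exact: cvg_cst. Qed.
Definition char_triv : character K :=
  Character (erefl _) (fun _ _ => esym (mulr1 1)) char_triv_continuous.

End Theory.
End Characters.

Record chom (K L : preTopGroupType) := CHom {
  chom_fun :> K -> L;
  chomM : forall x y, chom_fun (x * y)%g = (chom_fun x * chom_fun y)%g;
  chom_continuous : continuous chom_fun
}.

(* A quotient map identifies [L], as a topological group, with the quotient of
   [K] by its kernel. *)
Record qmap (K L : preTopGroupType) := QMap {
  qmap_chom :> chom K L;
  qmap_surj : forall y, exists x, qmap_chom x = y;
  qmap_open : forall U : set L, open (qmap_chom @^-1` U) -> open U
}.

Lemma chom1 K L (f : chom K L) : f 1%g = 1%g.
Proof. by apply: (@mulgI _ (f 1%g)); rewrite -chomM !mulg1. Qed.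

Section CharComp.
Variables (p : nat) (pr : prime p) (K L : preTopGroupType).
Variables (th : character pr L) (f : chom K L).
Fact char_comp1 : th (f 1%g) = 1. Proof. by rewrite chom1 char1. Qed.
Fact char_compM x y : th (f (x * y)%g) = th (f x) * th (f y).
Proof. by rewrite chomM charM. Qed.
Fact char_comp_continuous : continuous (fun g => th (f g)).
Proof.
move=> g; apply: (@continuous_comp _ _ _ f th).
  exact: chom_continuous.
exact: char_continuous.
Qed.
Definition char_comp : character pr K :=
  Character char_comp1 char_compM char_comp_continuous.
End CharComp.

Section ToUnit.
Variable K : preTopGroupType.
Fact to_unitM (x y : K) : tt = (tt * tt)%g. Proof. by []. Qed.
Fact to_unit_continuous : continuous (fun _ : K => tt).
Proof. by move=> g; exact: cvg_cst. Qed.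
Fact to_unit_surj (y : unit) : exists x : K, CHom to_unitM to_unit_continuous x = y.
Proof. by exists 1%g; case: y. Qed.
Fact to_unit_open (U : set unit) :
  open (CHom to_unitM to_unit_continuous @^-1` U) -> open U.
Proof. by []. Qed.
Definition to_unit : qmap K unit := QMap to_unit_surj to_unit_open.
End ToUnit.

Record normal_subgroup (K : groupType) := NormalSubgroup {
  nsub :> K -> Prop;
  nsub1 : nsub 1%g;
  nsubM : forall x y, nsub x -> nsub y -> nsub (x * y)%g;
  nsubV : forall x, nsub x -> nsub x^-1%g;
  nsubJ : forall x y, nsub x -> nsub (x ^ y)%g
}.

Section Quotient.
Variables (K : preTopGroupType) (N : normal_subgroup K).
Local Open Scope quotient_scope.

Definition same_coset (x y : K) : bool := `[< N (x^-1 * y)%g >].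

Fact same_coset_refl : reflexive same_coset.
Proof. by move=> x; apply/asboolP; rewrite mulVg; exact: nsub1. Qed.
Fact same_coset_sym : symmetric same_coset.
Proof.
move=> x y; apply/asboolP/asboolP => /nsubV; rewrite invgM invgK //.
Qed.
Fact same_coset_trans : transitive same_coset.
Proof.
move=> y x z /asboolP h /asboolP h'; apply/asboolP.
by have := nsubM h h'; rewrite mulgA mulgK.
Qed.

Canonical same_coset_equiv :=
  EquivRel same_coset same_coset_refl same_coset_sym same_coset_trans.

Definition quot_group : Type :=
  quotient_topology {eq_quot same_coset_equiv}.

HB.instance Definition _ := Topological.on quot_group.

Definition qcoset (x : K) : quot_group :=
  \pi_(quotient_topology {eq_quot same_coset_equiv}) x.
Definition coset_repr (c : quot_group) : K :=
  repr (c : quotient_topology {eq_quot same_coset_equiv}).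

Fact coset_reprK c : qcoset (coset_repr c) = c.
Proof. exact: (@reprK _ (quotient_topology {eq_quot same_coset_equiv})). Qed.

Fact qcosetP x y : qcoset x = qcoset y <-> N (x^-1 * y)%g.
Proof.
split=> [xy | xy]; first by apply/asboolP/(eqmodP same_coset_equiv).
by apply/(eqmodP same_coset_equiv)/asboolP.
Qed.

Fact coset_repr_of x : N (x^-1 * coset_repr (qcoset x))%g.
Proof. by apply/qcosetP; rewrite coset_reprK. Qed.

Definition quot_one := qcoset 1%g.
Definition quot_inv c := qcoset (coset_repr c)^-1%g.
Definition quot_mul c d := qcoset (coset_repr c * coset_repr d)%g.

Fact qcoset_mul x y : quot_mul (qcoset x) (qcoset y) = qcoset (x * y)%g.
Proof.
apply/esym/qcosetP; set x' := coset_repr _; set y' := coset_repr _.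
have Nx : N (x^-1 * x')%g := coset_repr_of x.
have Ny : N (y^-1 * y')%g := coset_repr_of y.
have -> : ((x * y)^-1 * (x' * y') = (x^-1 * x') ^ y * (y^-1 * y'))%g.
  by rewrite /conjg invgM -!mulgA mulVKg.
exact: nsubM (nsubJ _ Nx) Ny.
Qed.

Fact qcoset_inv x : quot_inv (qcoset x) = qcoset x^-1%g.
Proof.
apply/esym/qcosetP; set x' := coset_repr _; rewrite invgK.
have Nx : N (x^-1 * x')%g := coset_repr_of x.
have -> : (x * x'^-1 = ((x^-1 * x')^-1) ^ x^-1)%g.
  by rewrite /conjg invgM !invgK -!mulgA mulgV mulg1.
exact: nsubJ (nsubV Nx).
Qed.

Fact quot_ind (P : quot_group -> Prop) : (forall x, P (qcoset x)) -> forall c, P c.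
Proof. by move=> h c; rewrite -(coset_reprK c). Qed.

Fact quot_mulA : associative quot_mul.
Proof.
elim/quot_ind=> x; elim/quot_ind=> y; elim/quot_ind=> z.
by rewrite !qcoset_mul mulgA.
Qed.
Fact quot_mul1 : left_id quot_one quot_mul.
Proof. by elim/quot_ind=> x; rewrite qcoset_mul mul1g. Qed.
Fact quot_mulr1 : right_id quot_one quot_mul.
Proof. by elim/quot_ind=> x; rewrite qcoset_mul mulg1. Qed.
Fact quot_mulV : left_inverse quot_one quot_inv quot_mul.
Proof. by elim/quot_ind=> x; rewrite qcoset_inv qcoset_mul mulVg. Qed.
Fact quot_mulVr : right_inverse quot_one quot_inv quot_mul.
Proof. by elim/quot_ind=> x; rewrite qcoset_inv qcoset_mul mulgV. Qed.

HB.instance Definition _ := isGroup.Build quot_group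
  quot_mulA quot_mul1 quot_mulr1 quot_mulV quot_mulVr.

Fact qcosetM x y : qcoset (x * y)%g = (qcoset x * qcoset y)%g.
Proof. by rewrite -qcoset_mul. Qed.
Fact qcoset_continuous : continuous qcoset.
Proof. exact: pi_continuous. Qed.
Fact qcoset_surj c : exists x, CHom qcosetM qcoset_continuous x = c.
Proof. by exists (coset_repr c); exact: coset_reprK. Qed.
Fact qcoset_open (U : set quot_group) :
  open (CHom qcosetM qcoset_continuous @^-1` U) -> open U.
Proof. by []. Qed.
Definition quot_map : qmap K quot_group := QMap qcoset_surj qcoset_open.

End Quotient.

Record subgroup (K : groupType) := Subgroup {
  sgrp :> set K;
  sgrp1 : sgrp 1%g;
  sgrpM : forall x y, sgrp x -> sgrp y -> sgrp (x * y)%g;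
  sgrpV : forall x, sgrp x -> sgrp x^-1%g
}.

Section SubgroupTheory.
Variables (K : preTopGroupType) (S : subgroup K).

Definition sub_group : Type := set_type S.

HB.instance Definition _ := Topological.on sub_group.
HB.instance Definition _ := SubChoice.on sub_group.

Fact sub_group_closed : group_closed (mem (sgrp S)).
Proof.
split=> [|x y /set_mem Sx /set_mem Sy]; apply/mem_set; first exact: sgrp1.
exact: sgrpM Sx (sgrpV Sy).
Qed.

HB.instance Definition _ :=
  SubChoice_isSubGroup.Build K (mem (sgrp S)) sub_group sub_group_closed.

Fact sub_inclM (x y : sub_group) : val (x * y)%g = (val x * val y)%g.
Proof. by []. Qed.
Fact sub_incl_continuous : continuous (val : sub_group -> K).
Proof. exact: initial_continuous. Qed.
Definition sub_incl : chom sub_group K := CHom sub_inclM sub_incl_continuous.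
End SubgroupTheory.

Definition p_primary (p : nat) (V : zmodType) : Prop :=
  forall x : V, exists n, x *+ (p ^ n) = 0.

(* The action of Z_p on a p-primary abelian group: [u] acts on an element
   killed by p^n through its residue modulo p^n. *)
Section PadicAction.
Variables (p : nat) (pr : prime p) (V : zmodType) (Vp : p_primary p V).
Local Notation Zp := (padic_int pr).
Implicit Types (x y : V) (u v : Zp).

Definition padic_act (u : Zp) (x : V) : V :=
  x *+ residue u (projT1 (cid (Vp x))).

Fact mulrn_modn (W : zmodType) (x : W) k n : x *+ n = 0 -> x *+ (k %% n)%N = x *+ k.
Proof.
move=> xn; rewrite [in RHS](divn_eq k n) mulrnDr mulnC mulrnA xn mul0rn.
by rewrite add0r.
Qed.

Lemma padic_actE u x n : x *+ (p ^ n) = 0 -> padic_act u x = x *+ residue u n.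
Proof.
rewrite /padic_act; case: cid => k /= xk xn.
have H a b : (a <= b)%N -> x *+ (p ^ a) = 0 -> x *+ residue u a = x *+ residue u b.
  move=> le_ab xa; rewrite -(subnK le_ab) -[in LHS](residue_modD u a (b - a)).
  by rewrite mulrn_modn.
by case/orP: (leq_total k n) => /H h; [exact: h | exact/esym/h].
Qed.

Fact padic_act_common x y : exists n, x *+ (p ^ n) = 0 /\ y *+ (p ^ n) = 0.
Proof.
have [[m xm] [n yn]] := (Vp x, Vp y); exists (m + n)%N; rewrite expnD; split.
  by rewrite mulrnA xm mul0rn.
by rewrite mulnC mulrnA yn mul0rn.
Qed.

Fact mulrn_killed (x : V) n k : x *+ (p ^ n) = 0 -> x *+ k *+ (p ^ n) = 0.
Proof. by move=> xn; rewrite -mulrnA mulnC mulrnA xn mul0rn. Qed.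

Lemma padic_actD u x y : padic_act u (x + y) = padic_act u x + padic_act u y.
Proof.
have [n [xn yn]] := padic_act_common x y.
rewrite (padic_actE u xn) (padic_actE u yn) (@padic_actE u _ n).
  by rewrite mulrnDl.
by rewrite mulrnDl xn yn addr0.
Qed.

Lemma padic_act1 x : padic_act 1 x = x.
Proof. by have [n xn] := Vp x; rewrite (padic_actE _ xn) residue1 mulrn_modn. Qed.

Lemma padic_actM u v x : padic_act (u * v) x = padic_act u (padic_act v x).
Proof.
have [n xn] := Vp x; rewrite !(padic_actE _ xn) (@padic_actE u _ n).
  by rewrite residueM mulrn_modn // -mulrnA mulnC.
exact: mulrn_killed.
Qed.

Lemma padic_act0 u : padic_act u 0 = 0.
Proof. by rewrite /padic_act mul0rn. Qed.

Lemma padic_actN u x : padic_act u (- x) = - padic_act u x.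
Proof.
by apply: (addIr (padic_act u x)); rewrite -padic_actD !addNr padic_act0.
Qed.

Lemma padic_act_sum u I (r : seq I) (F : I -> V) :
  padic_act u (\sum_(i <- r) F i) = \sum_(i <- r) padic_act u (F i).
Proof.
elim/big_rec2: _ => [|i y x _ <-]; first exact: padic_act0.
by rewrite padic_actD.
Qed.

End PadicAction.

Lemma padic_act_additive p (pr : prime p) (V W : zmodType) (Vp : p_primary p V)
    (Wp : p_primary p W) (f : {additive V -> W}) (u : padic_int pr) x :
  f (padic_act Vp u x) = padic_act Wp u (f x).
Proof.
have [n xn] := Vp x; rewrite (padic_actE _ _ xn) (@padic_actE p pr W Wp u _ n).
  by rewrite raddfMn.
by rewrite -raddfMn xn raddf0.
Qed.

(* Mod_{K,p}^disc.  Since the module is discrete, the action K x M -> M is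
   continuous iff {g | g m = n} is open in K for all m and n. *)
Record dmod (p : nat) (K : preTopGroupType) := DMod {
  dm_sort :> zmodType;
  dm_act : K -> dm_sort -> dm_sort;
  dm_actB : forall g, {morph dm_act g : x y / x - y};
  dm_act1 : forall x, dm_act 1%g x = x;
  dm_actM : forall g h x, dm_act (g * h)%g x = dm_act g (dm_act h x);
  dm_primary : p_primary p dm_sort;
  dm_open : forall x y, open [set g | dm_act g x = y]
}.

HB.instance Definition _ p K (M : dmod p K) g :=
  GRing.isZmodMorphism.Build M M (dm_act g) (dm_actB g).

Record dhom p (K : preTopGroupType) (M N : dmod p K) := DHom {
  dh_fun :> M -> N;
  dhB : {morph dh_fun : x y / x - y};
  dh_act : forall g x, dh_fun (dm_act g x) = dm_act g (dh_fun x)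
}.

HB.instance Definition _ p K (M N : dmod p K) (f : dhom M N) :=
  GRing.isZmodMorphism.Build M N f (dhB f).

Section SubZmod.
Variables (M : zmodType) (S : {pred M}) (Sc : zmod_closed S).
Definition sub_zmod of zmod_closed S : Type := {x : M | x \in S}.
HB.instance Definition _ := SubChoice.on (sub_zmod Sc).
HB.instance Definition _ := GRing.SubChoice_isSubZmodule.Build M S (sub_zmod Sc) Sc.

Fact sub_zmod_primary p : p_primary p M -> p_primary p (sub_zmod Sc).
Proof.
move=> Mp x; have [n xn] := Mp (val x); exists n.
by apply: val_inj; rewrite raddfMn xn raddf0.
Qed.
End SubZmod.

(* Invariants: for a quotient map [f : K -> L], the [L]-module of the elements
   of [M] fixed by the kernel of [f]. *)
Section Invariants.
Variables (p : nat) (K L : preTopGroupType) (f : qmap K L) (M : dmod p K).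

Definition inv_pred : {pred M} :=
  fun x => `[< forall g, f g = 1%g -> dm_act g x = x >].

Fact inv_closed : zmod_closed inv_pred.
Proof.
split=> [|x y /asboolP hx /asboolP hy]; apply/asboolP => g g1.
  by rewrite raddf0.
by rewrite dm_actB hx ?hy.
Qed.

Definition inv_sort := sub_zmod inv_closed.

Definition qlift (q : L) : K := projT1 (cid (qmap_surj f q)).
Fact qliftK q : f (qlift q) = q.
Proof. by rewrite /qlift; case: cid. Qed.

Fact inv_lift g h (x : M) : x \in inv_pred -> f g = f h ->
  dm_act g x = dm_act h x.
Proof.
move=> /asboolP hx gh; rewrite -[g](mulVKg h) dm_actM hx //.
by apply: (@mulgI _ (f h)); rewrite -chomM mulVKg mulg1.
Qed.

Fact inv_act_subproof (q : L) (x : inv_sort) :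
  dm_act (qlift q) (val x) \in inv_pred.
Proof.
apply/asboolP => g g1; rewrite -dm_actM; apply: inv_lift (valP x) _.
by rewrite chomM g1 mul1g.
Qed.

Definition inv_act (q : L) (x : inv_sort) : inv_sort :=
  Sub (dm_act (qlift q) (val x)) (inv_act_subproof q x).

Lemma inv_actE g x : val (inv_act (f g) x) = dm_act g (val x).
Proof. by apply: inv_lift (valP x) _; rewrite qliftK. Qed.

Fact qmap_ind (P : L -> Prop) : (forall g, P (f g)) -> forall q, P q.
Proof. by move=> h q; rewrite -(qliftK q). Qed.

Fact inv_actB q : {morph inv_act q : x y / x - y}.
Proof. by move=> x y; apply: val_inj; rewrite /= raddfB. Qed.
Fact inv_act1 x : inv_act 1%g x = x.
Proof. by apply: val_inj; rewrite -(chom1 f) inv_actE dm_act1. Qed.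
Fact inv_actM q r x : inv_act (q * r)%g x = inv_act q (inv_act r x).
Proof.
apply: val_inj; elim/qmap_ind: q => g; elim/qmap_ind: r => h.
by rewrite -chomM !inv_actE dm_actM.
Qed.
Fact inv_open x y : open [set q | inv_act q x = y].
Proof.
apply: (qmap_open (q := f)).
have -> : f @^-1` [set q | inv_act q x = y] =
    [set g | dm_act g (val x) = val y].
  by apply/seteqP; split=> g /=; rewrite -inv_actE; [move->|move/val_inj].
exact: dm_open.
Qed.

Definition inv_dmod : dmod p L :=
  DMod inv_actB inv_act1 inv_actM
    (sub_zmod_primary (Sc := inv_closed) (@dm_primary _ _ M)) inv_open.
End Invariants.

Arguments inv_pred {p K L} f M.

Section InvariantsHom.
Variables (p : nat) (K L : preTopGroupType) (f : qmap K L) (M N : dmod p K).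
Variable u : dhom M N.

Fact inv_fun_subproof (x : inv_dmod f M) : u (val x) \in inv_pred f N.
Proof.
by apply/asboolP => g g1; rewrite -dh_act; have /asboolP-> := valP x.
Qed.
Definition inv_fun (x : inv_dmod f M) : inv_dmod f N :=
  Sub (u (val x)) (inv_fun_subproof x).
Fact inv_funB : {morph inv_fun : x y / x - y}.
Proof. by move=> x y; apply: val_inj; rewrite /= raddfB. Qed.
Fact inv_fun_act q x : inv_fun (dm_act q x) = dm_act q (inv_fun x).
Proof. by apply: val_inj; rewrite /= dh_act. Qed.
Definition inv_hom : dhom (inv_dmod f M) (inv_dmod f N) := DHom inv_funB inv_fun_act.
End InvariantsHom.

(* M{theta}; M(theta) is the twist by the composite of theta and G_S -> Gamma. *)
Section Twist.
Variables (p : nat) (pr : prime p) (K : preTopGroupType) (th : character pr K).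

Section Obj.
Variable M : dmod p K.
Local Notation Mp := (@dm_primary _ _ M).

Definition tw_act (g : K) (x : M) : M := padic_act Mp (th g) (dm_act g x).

Fact tw_actB g : {morph tw_act g : x y / x - y}.
Proof. by move=> x y; rewrite /tw_act raddfB padic_actD padic_actN. Qed.
Fact tw_act1 x : tw_act 1%g x = x.
Proof. by rewrite /tw_act char1 padic_act1 dm_act1. Qed.
Fact tw_actM g h x : tw_act (g * h)%g x = tw_act g (tw_act h x).
Proof.
rewrite /tw_act charM padic_actM dm_actM.
by rewrite (padic_act_additive Mp Mp (dm_act (d := M) g)).
Qed.
Fact tw_open x y : open [set g | tw_act g x = y].
Proof.
have [n xn] := Mp x.
have -> : [set g | tw_act g x = y] =
    \bigcup_(az in [set az : nat * M | az.2 *+ az.1 = y])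
      ([set g | residue (th g) n = az.1] `&` [set g | dm_act g x = az.2]).
  have E g : tw_act g x = dm_act g x *+ residue (th g) n.
    by rewrite /tw_act (@padic_actE _ _ _ _ _ _ n) // -raddfMn xn raddf0.
  apply/seteqP; split=> [g /= gy | g [[a z] /= azy [/= ga gz]]].
    by exists (residue (th g) n, dm_act g x) => //=; rewrite -E.
  by rewrite E ga gz.
apply: bigcup_open => az _; apply: openI; last exact: dm_open.
by apply: continuous_residue; exact: char_continuous.
Qed.

Definition twist_dmod : dmod p K := DMod tw_actB tw_act1 tw_actM Mp tw_open.
End Obj.

Section Hom.
Variables (M N : dmod p K) (u : dhom M N).
Fact tw_fun_act g (x : twist_dmod M) :
  u (dm_act g x : M) = dm_act (d := twist_dmod N) g (u x).
Proof. by rewrite /= /tw_act (padic_act_additive _ (@dm_primary _ _ N) u) /= dh_act. Qed.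
Definition twist_hom : dhom (twist_dmod M) (twist_dmod N) :=
  @DHom _ _ (twist_dmod M) (twist_dmod N) u (dhB u) tw_fun_act.
End Hom.
End Twist.

Section Pullback.
Variables (p : nat) (K L : preTopGroupType) (f : chom K L).
Section Obj.
Variable M : dmod p L.
Fact res_actB (g : K) : {morph dm_act (d := M) (f g) : x y / x - y}.
Proof. exact: dm_actB. Qed.
Fact res_act1 (x : M) : dm_act (f 1%g) x = x.
Proof. by rewrite chom1 dm_act1. Qed.
Fact res_actM g h (x : M) : dm_act (f (g * h)%g) x = dm_act (f g) (dm_act (f h) x).
Proof. by rewrite chomM dm_actM. Qed.
Fact res_open (x y : M) : open [set g | dm_act (f g) x = y].
Proof.
have fc := @chom_continuous _ _ f.
by move/continuousP: fc => /(_ _ (dm_open x y)).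
Qed.
Definition res_dmod : dmod p K :=
  DMod res_actB res_act1 res_actM (@dm_primary _ _ M) res_open.
End Obj.
Definition res_hom (M N : dmod p L) (u : dhom M N) : dhom (res_dmod M) (res_dmod N) :=
  @DHom _ _ (res_dmod M) (res_dmod N) u (dhB u) (fun g => dh_act u (f g)).
End Pullback.

(* The endofunctor e M of Mod_{K,p}^disc, for K commutative and
   e = a * (\sum_(d <- s) w(d) [d]) in Z_p[K]. *)
Section GroupRing.
Variables (p : nat) (pr : prime p) (K : preTopGroupType).
Hypothesis Kab : forall x y : K, (x * y = y * x)%g.
Variables (a : padic_int pr) (s : seq K) (w : K -> padic_int pr).

Definition gring_act (M : dmod p K) (x : M) : M :=
  padic_act (@dm_primary _ _ M) a
    (\sum_(d <- s) padic_act (@dm_primary _ _ M) (w d) (dm_act d x)).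

Section Obj.
Variable M : dmod p K.
Local Notation Mp := (@dm_primary _ _ M).

Fact gring_actB : {morph gring_act (M := M) : x y / x - y}.
Proof.
move=> x y; rewrite /gring_act -padic_actN -padic_actD -sumrB.
by under eq_bigr do rewrite raddfB padic_actD padic_actN.
Qed.

Definition gring_pred : {pred M} := fun x => `[< exists y, x = gring_act y >].

Fact gring_closed : zmod_closed gring_pred.
Proof.
split=> [|_ _ /asboolP[x ->] /asboolP[y ->]]; apply/asboolP.
  by exists 0; rewrite -[in RHS](subrr 0) gring_actB subrr.
by exists (x - y); rewrite gring_actB.
Qed.
End Obj.

Fact gring_act_hom (M N : dmod p K) (u : dhom M N) (x : M) :
  u (gring_act x) = gring_act (u x).
Proof.
rewrite /gring_act (padic_act_additive _ (@dm_primary _ _ N) u) raddf_sum.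
by under eq_bigr do rewrite (padic_act_additive _ (@dm_primary _ _ N) u) /= dh_act.
Qed.

Section Obj2.
Variable M : dmod p K.
Local Notation Mp := (@dm_primary _ _ M).

Fact gring_stable g (x : sub_zmod (@gring_closed M)) :
  dm_act g (val x) \in @gring_pred M.
Proof.
have /asboolP[y xy] := valP x; apply/asboolP; exists (dm_act g y).
have gE h z : dm_act (d := M) g (dm_act h z) = dm_act h (dm_act g z).
  by rewrite -!dm_actM Kab.
by rewrite xy; exact: (gring_act_hom (@DHom _ _ M M (dm_act g) (dm_actB g) gE)).
Qed.

Definition gring_sub_act g (x : sub_zmod (@gring_closed M)) :
  sub_zmod (@gring_closed M) := Sub (dm_act g (val x)) (gring_stable g x).

Fact gring_sub_actB g : {morph gring_sub_act g : x y / x - y}.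
Proof. by move=> x y; apply: val_inj; rewrite /= raddfB. Qed.
Fact gring_sub_act1 x : gring_sub_act 1%g x = x.
Proof. by apply: val_inj; rewrite /= dm_act1. Qed.
Fact gring_sub_actM g h x :
  gring_sub_act (g * h)%g x = gring_sub_act g (gring_sub_act h x).
Proof. by apply: val_inj; rewrite /= dm_actM. Qed.
Fact gring_sub_open x y : open [set g | gring_sub_act g x = y].
Proof.
have -> : [set g | gring_sub_act g x = y] = [set g | dm_act g (val x) = val y].
  by apply/seteqP; split=> g /= => [<-//|h]; apply: val_inj.
exact: dm_open.
Qed.
Definition gring_img : dmod p K :=
  DMod gring_sub_actB gring_sub_act1 gring_sub_actM
    (sub_zmod_primary (Sc := @gring_closed M) Mp) gring_sub_open.
End Obj2.

Section Hom.
Variables (M N : dmod p K) (u : dhom M N).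
Fact gring_fun_subproof (x : gring_img M) : u (val x) \in @gring_pred N.
Proof.
have /asboolP[y xy] := valP x; apply/asboolP; exists (u y).
by rewrite xy gring_act_hom.
Qed.
Definition gring_fun (x : gring_img M) : gring_img N :=
  Sub (u (val x)) (gring_fun_subproof x).
Fact gring_funB : {morph gring_fun : x y / x - y}.
Proof. by move=> x y; apply: val_inj; rewrite /= raddfB. Qed.
Fact gring_fun_act g x : gring_fun (dm_act g x) = dm_act g (gring_fun x).
Proof. by apply: val_inj; rewrite /= dh_act. Qed.
Definition gring_hom : dhom (gring_img M) (gring_img N) :=
  DHom gring_funB gring_fun_act.
End Hom.
End GroupRing.

Section TrivialAction.
Variables (p : nat) (K : preTopGroupType) (A : zmodType) (Ap : p_primary p A).
Fact triv_actB (g : K) : {morph (fun x : A => x) : x y / x - y}.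
Proof. by []. Qed.
Fact triv_open (x y : A) : open [set _ : K | x = y].
Proof.
have [xy|xy] := pselect (x = y).
  have -> : [set _ : K | x = y] = setT by apply/seteqP; split.
  exact: openT.
have -> : [set _ : K | x = y] = set0 by apply/seteqP; split.
exact: open0.
Qed.
Definition triv_dmod : dmod p K :=
  @DMod p K A (fun _ x => x) triv_actB (fun _ => erefl) (fun _ _ _ => erefl)
    Ap triv_open.
End TrivialAction.

Record complex p (K : preTopGroupType) := Complex {
  cx_obj :> int -> dmod p K;
  cx_d : forall n, dhom (cx_obj n) (cx_obj (n + 1));
  cx_dd : forall n x, cx_d (n + 1) (cx_d n x) = 0
}.

Record chain_map p (K : preTopGroupType) (C D : complex p K) := ChainMap {
  cm_fun :> forall n, dhom (C n) (D n);
  cm_d : forall n x, cm_fun (n + 1) (cx_d C n x) = cx_d D n (cm_fun n x)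
}.

Section Complexes.
Variables (p : nat) (K : preTopGroupType).
Implicit Types (M N : dmod p K) (C D I : complex p K).

Definition bounded_below C : Prop :=
  exists n0 : int, forall n, (n < n0)%R -> forall x : C n, x = 0.

(* The two conjuncts say that H^(n+1)(f) is injective and surjective; indexing
   by n + 1 avoids casts between C n and C (n - 1 + 1). *)
Definition quasi_iso C D (f : chain_map C D) : Prop := forall n : int,
  (forall x : C (n + 1), cx_d C (n + 1) x = 0 ->
     (exists y : D n, f (n + 1) x = cx_d D n y) ->
     exists z : C n, x = cx_d C n z) /\
  (forall y : D (n + 1), cx_d D (n + 1) y = 0 ->
     exists x : C (n + 1), cx_d C (n + 1) x = 0 /\
     exists z : D n, y = f (n + 1) x + cx_d D n z).

Definition injective_dmod M : Prop :=
  forall (A B : dmod p K) (i : dhom A B) (f : dhom A M),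
    injective i -> exists g : dhom B M, forall x, g (i x) = f x.

(* Objects of D^+(Mod_{K,p}^disc) in its realization by bounded-below
   complexes of injectives. *)
Definition dplus_object I : Prop :=
  bounded_below I /\ forall n, injective_dmod (I n).

Definition injective_resolution C I : Prop :=
  dplus_object I /\ exists f : chain_map C I, quasi_iso f.

(* C and D are equivalent in D^+(Mod_{K,p}^disc) iff they have a common
   injective resolution. *)
Definition dplus_equiv C D : Prop :=
  exists I, injective_resolution C I /\ injective_resolution D I.

Fact zero_homB M N : {morph (fun _ : M => 0 : N) : x y / x - y}.
Proof. by move=> x y; rewrite subrr. Qed.
Fact zero_hom_act M N g (x : M) : 0 = dm_act g (0 : N).
Proof. by rewrite raddf0. Qed.
Definition zero_hom M N : dhom M N :=
  DHom (@zero_homB M N) (@zero_hom_act M N).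

Fact zero_primary : p_primary p 'I_1.
Proof. by move=> x; exists 0%N; rewrite [LHS]ord1. Qed.
Definition zero_dmod : dmod p K := triv_dmod K zero_primary.

Definition in_degree0 M : complex p K :=
  @Complex p K (fun n => if n == 0 then M else zero_dmod)
    (fun n => zero_hom _ _) (fun n x => erefl).

End Complexes.

Section FunctorsOnComplexes.
Variables (p : nat) (pr : prime p) (K L : preTopGroupType).

Definition invC (f : qmap K L) (C : complex p K) : complex p L.
Proof.
refine (@Complex p L (fun n => inv_dmod f (C n)) (fun n => inv_hom f (cx_d C n)) _).
by move=> n x; apply: val_inj; exact: cx_dd.
Defined.

Definition twistC (th : character pr K) (C : complex p K) : complex p K :=
  @Complex p K (fun n => twist_dmod th (C n)) (fun n => twist_hom th (cx_d C n))
    (@cx_dd _ _ C).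

Definition resC (f : chom K L) (C : complex p L) : complex p K :=
  @Complex p K (fun n => res_dmod f (C n)) (fun n => res_hom f (cx_d C n))
    (@cx_dd _ _ C).

Section GroupRingC.
Hypothesis Kab : forall x y : K, (x * y = y * x)%g.
Variables (a : padic_int pr) (s : seq K) (w : K -> padic_int pr).
Definition gringC (C : complex p K) : complex p K.
Proof.
refine (@Complex p K (fun n => gring_img Kab a s w (C n))
  (fun n => gring_hom Kab a s w (cx_d C n)) _).
by move=> n x; apply: val_inj; exact: cx_dd.
Defined.
End GroupRingC.
End FunctorsOnComplexes.

(* [D] represents R Gamma(ker f, C), for a quotient map [f : K -> L], if it is
   the complex of invariants of some injective resolution of [C]. *)
Definition is_RGamma p (K L : preTopGroupType) (f : qmap K L)
    (C : complex p K) (D : complex p L) : Prop :=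
  exists I, injective_resolution C I /\ D = invC f I.

Section GeneratedSubfield.
Variables (F : fieldType) (X : set F).

Definition gen_subfield : {pred F} := fun x =>
  `[< forall L : {pred F}, divring_closed L -> (forall y, X y -> y \in L) ->
      x \in L >].

Lemma gen_subfield_min (L : {pred F}) : divring_closed L ->
  (forall y, X y -> y \in L) -> {subset gen_subfield <= L}.
Proof. by move=> Lc XL x /asboolP; apply. Qed.

Lemma gen_subfield_sub y : X y -> y \in gen_subfield.
Proof. by move=> Xy; apply/asboolP => L _; apply. Qed.

Fact gen_subfield_closed : divring_closed gen_subfield.
Proof.
split=> [|x y /asboolP hx /asboolP hy|x y /asboolP hx /asboolP hy];
  apply/asboolP => L Lc XL; have [L1 LB LV] := Lc => //.
  by apply: LB; [exact: hx | exact: hy].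
by apply: LV; [exact: hx | exact: hy].
Qed.
End GeneratedSubfield.

Definition number_field (K : {pred algC}) : Prop :=
  divring_closed K /\ exists s : seq algC, {subset K <= Crat_span s}.

Definition integers_of (K : {pred algC}) : set algC :=
  [set x | x \in K /\ x \in Aint].

Definition prime_ideal (O P : set algC) : Prop :=
  [/\ P `<=` O /\ P 0,
      forall x y, P x -> P y -> P (x + y),
      forall a x, O a -> P x -> P (a * x),
      ~ P 1
    & forall a b, O a -> O b -> P (a * b) -> P a \/ P b].

Definition ideal_square (P : set algC) : set algC :=
  [set x | exists s : seq (algC * algC),
     (forall ab, ab \in s -> P ab.1 /\ P ab.2) /\
     x = \sum_(ab <- s) ab.1 * ab.2].

(* Every prime P of K above l has ramification index 1, i.e. l lies in P but
   not in P^2; the residue extensions, being finite fields, are separable. *)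
Definition unramified_at (l : nat) (K : {pred algC}) : Prop :=
  forall P, prime_ideal (integers_of K) P -> P l%:R -> ~ ideal_square P l%:R.

(* There is no condition at infinity, since it belongs to S. *)
Definition unramified_outside (p : nat) (K : {pred algC}) : Prop :=
  forall l : nat, prime l -> l != p -> unramified_at l K.

(* Q_S, as the compositum in algC of the number fields unramified outside S. *)
Section QS.
Variable p : nat.

Definition QS_pred : {pred algC} := gen_subfield [set x | exists K : {pred algC},
  [/\ number_field K, unramified_outside p K & x \in K]].

HB.instance Definition _ := GRing.isDivringClosed.Build algC QS_pred
  (gen_subfield_closed _).

Record QS : Type := InQS { QS_val : algC; QS_valP : QS_val \in QS_pred }.
HB.instance Definition _ := [isSub for QS_val].
HB.instance Definition _ := [Choice of QS by <:].
HB.instance Definition _ := [SubChoice_isSubComUnitRing of QS by <:].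
HB.instance Definition _ := [SubComUnitRing_isSubIntegralDomain of QS by <:].
HB.instance Definition _ := [SubIntegralDomain_isSubField of QS by <:].
End QS.

(* The group of all the automorphisms of L, which are automatically Q-linear,
   with the Krull topology, for L an algebraic extension of Q. *)
Section GaloisGroup.
Variable L : fieldType.

Definition is_aut (f : L -> L) : bool :=
  `[< [/\ {morph f : x y / x - y}, f 1 = 1, {morph f : x y / x * y}
        & bijective f] >].

Record galgrp : Type := Gal { gal_fun :> L -> L; gal_funP : is_aut gal_fun }.
HB.instance Definition _ := [isSub for gal_fun].
HB.instance Definition _ := [Choice of galgrp by <:].

Implicit Types f g h : galgrp.

Lemma galP f : [/\ {morph f : x y / x - y}, f 1 = 1, {morph f : x y / x * y}
  & bijective f].
Proof. exact/asboolP/(gal_funP f). Qed.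

Fact gal_one_subproof : is_aut id.
Proof. by apply/asboolP; split=> //; exists id. Qed.
Fact gal_mul_subproof f g : is_aut (f \o g).
Proof.
have [fB f1 fM fb] := galP f; have [gB g1 gM gb] := galP g.
apply/asboolP; split; [| by rewrite /= g1 | | exact: bij_comp].
  by move=> x y; rewrite /= gB.
by move=> x y; rewrite /= gM.
Qed.
Fact gal_inv_ex f : exists2 g : L -> L, cancel f g & cancel g f.
Proof. by have [_ _ _ [g fg gf]] := galP f; exists g. Qed.
Definition gal_inv_fun f : L -> L := s2val (cid2 (gal_inv_ex f)).
Fact gal_funK f : cancel f (gal_inv_fun f).
Proof. by rewrite /gal_inv_fun; case: cid2. Qed.
Fact gal_invK f : cancel (gal_inv_fun f) f.
Proof. by rewrite /gal_inv_fun; case: cid2. Qed.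
Fact gal_inv_subproof f : is_aut (gal_inv_fun f).
Proof.
have [fB f1 fM fb] := galP f; have fI := bij_inj fb.
apply/asboolP; split.
- by move=> x y; apply: fI; rewrite fB !gal_invK.
- by apply: fI; rewrite gal_invK f1.
- by move=> x y; apply: fI; rewrite fM !gal_invK.
- by exists f; [exact: gal_invK | exact: gal_funK].
Qed.

Definition gal_one := Gal gal_one_subproof.
Definition gal_mul f g := Gal (gal_mul_subproof f g).
Definition gal_inv f := Gal (gal_inv_subproof f).

Fact gal_mulA : associative gal_mul. Proof. by move=> f g h; apply: val_inj. Qed.
Fact gal_mul1 : left_id gal_one gal_mul. Proof. by move=> f; apply: val_inj. Qed.
Fact gal_mulr1 : right_id gal_one gal_mul. Proof. by move=> f; apply: val_inj. Qed.
Fact gal_mulV : left_inverse gal_one gal_inv gal_mul.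
Proof. by move=> f; apply/val_inj/funext => x; exact: gal_funK. Qed.
Fact gal_mulVr : right_inverse gal_one gal_inv gal_mul.
Proof. by move=> f; apply/val_inj/funext => x; exact: gal_invK. Qed.

HB.instance Definition _ := isGroup.Build galgrp
  gal_mulA gal_mul1 gal_mulr1 gal_mulV gal_mulVr.

Definition krull_open : set (set galgrp) := [set U | forall f, U f ->
  exists s : seq L, forall g, {in s, g =1 f} -> U g].

Fact krull_openT : krull_open setT. Proof. by move=> f _; exists [::]. Qed.
Fact krull_openI : setI_closed krull_open.
Proof.
move=> U V oU oV f [/oU[s sU] /oV[t tV]]; exists (s ++ t) => g gf.
by split; [apply: sU | apply: tV] => x xs; apply: gf; rewrite mem_cat xs ?orbT.
Qed.
Fact krull_open_bigU (I : Type) (F : I -> set galgrp) :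
  (forall i, krull_open (F i)) -> krull_open (\bigcup_i F i).
Proof.
by move=> oF f [i _ /oF[s sF]]; exists s => g gf; exists i => //; exact: sF.
Qed.
HB.instance Definition _ :=
  isOpenTopological.Build galgrp krull_openT krull_openI krull_open_bigU.

HB.instance Definition _ f := GRing.isZmodMorphism.Build L L f
  (let: And4 fB _ _ _ := galP f in fB).
HB.instance Definition _ f := GRing.isMonoidMorphism.Build L L f
  (let: And4 _ f1 fM _ := galP f in (f1, fM)).

Lemma gal_mulE f g x : (f * g)%g x = f (g x). Proof. by []. Qed.
Lemma gal1E x : (1%g : galgrp) x = x. Proof. by []. Qed.
End GaloisGroup.

(* H = Gal(Q_S/F_oo), where F_oo is the subfield of Q_S generated by the roots
   of unity of p-power order; Q_S contains all those of algC, since Q(mu_{p^n})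
   is unramified outside p. *)
Section Cyclotomic.
Variables (p : nat) (pr : prime p).

Definition G_S : preTopGroupType := galgrp (QS p).

Definition mu_pinfty : set (QS p) := [set z | exists n, z ^+ (p ^ n) = 1].
Definition F_infty : {pred QS p} := gen_subfield mu_pinfty.

Definition fixes_F_infty (g : galgrp (QS p)) : Prop := {in F_infty, forall x, g x = x}.

Fact F_infty_gal (g : galgrp (QS p)) x : x \in F_infty -> g x \in F_infty.
Proof.
move=> xF; pose L : {pred QS p} := fun y => g y \in F_infty.
have [F1 FB FV] := gen_subfield_closed mu_pinfty.
have : x \in L; last by [].
apply: gen_subfield_min xF => [|y [n yn]].
  split=> [|a b ha hb|a b ha hb]; rewrite unfold_in /L ?rmorph1 //.
  - by rewrite rmorphB; apply: FB.
  - by rewrite fmorph_div; apply: FV.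
by apply: gen_subfield_sub; exists n; rewrite -rmorphXn yn rmorph1.
Qed.

Fact H_S_1 : fixes_F_infty 1%g. Proof. by []. Qed.
Fact H_S_M g h : fixes_F_infty g -> fixes_F_infty h -> fixes_F_infty (g * h)%g.
Proof. by move=> hg hh x xF; rewrite gal_mulE hh ?hg. Qed.
Fact H_S_V g : fixes_F_infty g -> fixes_F_infty g^-1%g.
Proof. by move=> hg x xF; rewrite -{1}(hg x xF) -gal_mulE mulVg. Qed.
Fact H_S_J g h : fixes_F_infty g -> fixes_F_infty (g ^ h)%g.
Proof.
move=> hg x xF; rewrite /conjg !gal_mulE hg; last exact: F_infty_gal.
by rewrite -gal_mulE mulVg.
Qed.

Definition H_S : normal_subgroup G_S :=
  @NormalSubgroup G_S fixes_F_infty H_S_1 H_S_M H_S_V H_S_J.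

Definition Gamma : preTopGroupType := quot_group H_S.
Definition toGamma : qmap G_S Gamma := quot_map H_S.

Fact gal_root_exp (g : galgrp (QS p)) z n : z ^+ (p ^ n) = 1 -> exists a, g z = z ^+ a.
Proof.
move=> zn; have pn0 : (0 < p ^ n)%N by rewrite expn_gt0 prime_gt0.
have [m zm _] := prim_order_exists pn0 zn.
have [|a ->] := prim_rootP zm (x := g z); last by exists a.
by rewrite -rmorphXn (prim_expr_order zm) rmorph1.
Qed.

Fact commutator_fixes (g h : galgrp (QS p)) : fixes_F_infty ((g * h)^-1 * (h * g))%g.
Proof.
pose L : {pred QS p} := fun x => g (h x) == h (g x).
suff FL x : x \in F_infty -> x \in L.
  move=> x /FL /eqP xL.
  by rewrite gal_mulE [(h * g)%g x]gal_mulE -xL -[g (h x)]gal_mulE -gal_mulE mulVg.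
apply: gen_subfield_min => [|z [n zn]].
  split=> [|a b /eqP ha /eqP hb|a b /eqP ha /eqP hb]; rewrite unfold_in /L.
  - by rewrite !rmorph1.
  - by rewrite !rmorphB /= ha hb.
  - by rewrite !fmorph_div /= ha hb.
have [[a ga] [b hb]] := (gal_root_exp g zn, gal_root_exp h zn).
by apply/eqP; rewrite ga hb !rmorphXn /= ga hb -!exprM mulnC.
Qed.

Fact Gamma_comm (x y : Gamma) : (x * y = y * x)%g.
Proof.
have [g <-] := qmap_surj toGamma x; have [h <-] := qmap_surj toGamma y.
rewrite -!chomM; apply/qcosetP; exact: commutator_fixes.
Qed.

Definition is_cyclotomic (chi : character pr Gamma) : Prop :=
  forall (g : galgrp (QS p)) (n : nat) (z : QS p), z ^+ (p ^ n) = 1 ->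
    g z = z ^+ residue (chi (toGamma g)) n.

(* chi_Gamma is the continuous character satisfying [is_cyclotomic], which is
   unique because Q_S contains the roots of unity of p-power order. *)
Definition chi : character pr Gamma :=
  xget (char_triv pr Gamma) [set c | is_cyclotomic c].

Definition Delta : set Gamma := [set d | chi d ^+ p.-1 = 1].

Definition in_Gamma1 : set Gamma := [set g | exists v, chi g = 1 + p%:R * v].
Fact Gamma1_1 : in_Gamma1 1%g.
Proof. by exists 0; rewrite char1 mulr0 addr0. Qed.
Fact Gamma1_M g h : in_Gamma1 g -> in_Gamma1 h -> in_Gamma1 (g * h)%g.
Proof.
move=> [v gv] [w hw]; exists (v + w + p%:R * v * w); rewrite charM gv hw.
ring.
Qed.
Fact Gamma1_V g : in_Gamma1 g -> in_Gamma1 g^-1%g.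
Proof.
move=> [v gv]; exists (- (v * chi g^-1%g)).
have e : chi g * chi g^-1%g = 1 by rewrite -charM mulgV char1.
by rewrite mulrN mulrA; apply/eqP; rewrite eq_sym subr_eq eq_sym -{2}e gv mulrDl mul1r.
Qed.
Definition Gamma1_subgroup : subgroup Gamma :=
  Subgroup Gamma1_1 Gamma1_M Gamma1_V.
Definition Gamma1 : preTopGroupType := sub_group Gamma1_subgroup.
Definition Gamma1_incl : chom Gamma1 Gamma := sub_incl Gamma1_subgroup.

(* e_j, for j in Z/(p-1).  [fset_set] enumerates the finite set Delta, and the
   exponent -j makes sense because chi d ^+ p.-1 = 1 for d in Delta. *)
Definition e_ (j : 'Z_(p.-1)) : complex p Gamma -> complex p Gamma :=
  gringC Gamma_comm (p.-1%:R^-1) (fset_set Delta)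
    (fun d => chi d ^+ (- j : 'Z_(p.-1))%R).

End Cyclotomic.

(* Main.v *)
From HB Require Import structures.
Require Import Defs.
From mathcomp Require Import all_boot all_order all_algebra all_field cyclic.
From mathcomp Require Import all_classical.
From mathcomp Require Import topology.
From mathcomp Require Import ring finmap zify.

Set Implicit Arguments.
Unset Strict Implicit.
Unset Printing Implicit Defensive.

Import Order.TTheory GRing.Theory Num.Theory.
Local Open Scope classical_set_scope.
Local Open Scope ring_scope.

(* Let I be an injective resolution of A over G.  Then I(theta) is one of
   A(theta), so that R Gamma(G, A(theta)) is computed by I(theta)^G, that is, by
   the elements of I^H on which Gamma acts through theta^-1.  As
   Gamma = Delta x Gamma_1, these are the Gamma_1-invariants of
   (e_(-m) I^H){theta}, whose terms are injective over Gamma_1: they are direct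
   summands of twists of injective Gamma-modules, on which Delta acts trivially,
   hence injective over Gamma / Delta = Gamma_1.

   The decomposition of Gamma needs that chi exists, is injective and takes all
   the needed Teichmueller values.  It exists because Q(mu_{p^n}) is unramified
   at l != p: p^n O_K is contained in Z[mu_{p^n}], so that the power q = l^f,
   with q = 1 mod p^n, satisfies x^q = x mod l for every integer x of
   Q(mu_{p^n}).  A Teichmueller lift of g is a limit of the g^(p^k). *)

(** * Injective resolutions of discrete modules *)

(** The complexes in the statement come from unrelated resolutions: I of A and J of A(theta) over G,
    and K of the restriction of (e I^H){theta} to Gamma_1. They are linked by J^G -> I(theta)^G ->
    ((e I^H){theta})^(Gamma_1) -> K^(Gamma_1). The middle map is bijective in each degree. The outer
    ones are the invariants of quasi-isomorphisms between bounded-below complexes of injectives, and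
    remain quasi-isomorphisms because the cone of such a map is contracted by equivariant maps.

    The index is -m because e_(-m) gives d the weight chi(d)^m = theta(d): up to a scalar, it
    averages over the action of Delta on the twist. On the Delta-invariants of the twist it acts by
    |Delta|/(p - 1), a p-adic unit because reduction mod p embeds Delta in the nonzero residues.

    [chi] is chosen by [xget] with the trivial character as default, so its injectivity depends on
    the existence of a cyclotomic character, hence on the presence of the p-power roots of unity in
    Q_S. *)

Section Modules.
Variables (p : nat) (K : preTopGroupType).
Implicit Types (M N B Q : dmod p K).

Section SubModule.
Variables (M : dmod p K) (S : {pred M}) (Sc : zmod_closed S).
Hypothesis Sst : forall g x, x \in S -> dm_act g x \in S.

Definition sub_dm_act g (x : sub_zmod Sc) : sub_zmod Sc :=
  Sub (dm_act g (val x)) (Sst g (valP x)).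
Fact sub_dm_actB g : {morph sub_dm_act g : x y / x - y}.
Proof. by move=> x y; apply: val_inj; rewrite /= raddfB. Qed.
Fact sub_dm_act1 x : sub_dm_act 1%g x = x.
Proof. by apply: val_inj; rewrite /= dm_act1. Qed.
Fact sub_dm_actM g h x : sub_dm_act (g * h)%g x = sub_dm_act g (sub_dm_act h x).
Proof. by apply: val_inj; rewrite /= dm_actM. Qed.
Fact sub_dm_open x y : open [set g | sub_dm_act g x = y].
Proof.
have -> : [set g | sub_dm_act g x = y] = [set g | dm_act g (val x) = val y].
  by apply/seteqP; split=> g /= => [<-//|h]; apply: val_inj.
exact: dm_open.
Qed.
Definition sub_dmod : dmod p K :=
  DMod sub_dm_actB sub_dm_act1 sub_dm_actM
    (sub_zmod_primary (Sc := Sc) (@dm_primary _ _ M)) sub_dm_open.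
Definition sub_dm_incl : dhom sub_dmod M :=
  @DHom _ _ sub_dmod M val (fun _ _ => erefl) (fun _ _ => erefl).
End SubModule.

Section SumModule.
Variables M N : dmod p K.
Definition sum_act g (x : M * N) : M * N := (dm_act g x.1, dm_act g x.2).
Fact sum_actB g : {morph sum_act g : x y / x - y}.
Proof. by move=> [a b] [c d]; rewrite /sum_act /= !raddfB. Qed.
Fact sum_act1 x : sum_act 1%g x = x.
Proof. by case: x => a b; rewrite /sum_act /= !dm_act1. Qed.
Fact sum_actM g h x : sum_act (g * h)%g x = sum_act g (sum_act h x).
Proof. by rewrite /sum_act /= !dm_actM. Qed.
Fact sum_primary : p_primary p (M * N)%type.
Proof.
have nE (x : M * N) n : x *+ n = (x.1 *+ n, x.2 *+ n).
  by elim: n => [|n IH]; rewrite ?mulr0n // !mulrS IH.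
move=> x; have [m xm] := @dm_primary _ _ M x.1.
have [n xn] := @dm_primary _ _ N x.2; exists (m + n)%N.
rewrite nE expnD; congr pair; first by rewrite mulrnA xm mul0rn.
by rewrite mulnC mulrnA xn mul0rn.
Qed.
Fact sum_open x y : open [set g | sum_act g x = y].
Proof.
have -> : [set g | sum_act g x = y] =
    [set g | dm_act g x.1 = y.1] `&` [set g | dm_act g x.2 = y.2].
  by apply/seteqP; case: y => y1 y2; split=> g /= => [[-> ->]|[<- <-]].
by apply: openI; exact: dm_open.
Qed.
Definition sum_dmod : dmod p K :=
  DMod sum_actB sum_act1 sum_actM sum_primary sum_open.
End SumModule.

Section Hom.
Variables (M N Q : dmod p K).
Section Comp.
Variables (g : dhom N Q) (f : dhom M N).
Fact dcompB : {morph (fun x => g (f x)) : x y / x - y}.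
Proof. by move=> x y; rewrite !raddfB. Qed.
Fact dcomp_act h x : g (f (dm_act h x)) = dm_act h (g (f x)).
Proof. by rewrite !dh_act. Qed.
Definition dcomp : dhom M Q := DHom dcompB dcomp_act.
End Comp.
Section Sub.
Variables (f g : dhom M N).
Fact dsubB : {morph (fun x => f x - g x) : x y / x - y}.
Proof. by move=> x y; rewrite !raddfB addrACA. Qed.
Fact dsub_act h x : f (dm_act h x) - g (dm_act h x) = dm_act h (f x - g x).
Proof. by rewrite raddfB !dh_act. Qed.
Definition dsub : dhom M N := DHom dsubB dsub_act.
End Sub.
Section Pair.
Variables (f : dhom Q M) (g : dhom Q N).
Fact dpairB : {morph (fun x => (f x, g x) : sum_dmod M N) : x y / x - y}.
Proof. by move=> x y; rewrite !raddfB. Qed.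
Fact dpair_act h x :
  (f (dm_act h x), g (dm_act h x)) = dm_act h ((f x, g x) : sum_dmod M N).
Proof. by rewrite !dh_act. Qed.
Definition dpair : dhom Q (sum_dmod M N) := DHom dpairB dpair_act.
End Pair.
Section Copair.
Variables (f : dhom M Q) (g : dhom N Q).
Fact dcopairB : {morph (fun x : sum_dmod M N => f x.1 + g x.2) : x y / x - y}.
Proof. by move=> x y; rewrite !raddfB /= opprD addrACA. Qed.
Fact dcopair_act h (x : sum_dmod M N) :
  f (dm_act h x).1 + g (dm_act h x).2 = dm_act h (f x.1 + g x.2).
Proof. by rewrite raddfD /= !dh_act. Qed.
Definition dcopair : dhom (sum_dmod M N) Q := DHom dcopairB dcopair_act.
End Copair.
Definition dfst : dhom (sum_dmod M N) M :=
  @DHom _ _ (sum_dmod M N) M fst (fun _ _ => erefl) (fun _ _ => erefl).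
Definition dsnd : dhom (sum_dmod M N) N :=
  @DHom _ _ (sum_dmod M N) N snd (fun _ _ => erefl) (fun _ _ => erefl).
Definition did : dhom M M :=
  @DHom _ _ M M id (fun _ _ => erefl) (fun _ _ => erefl).
End Hom.

Lemma dm_act0 M g : dm_act (d := M) g 0 = 0. Proof. exact: raddf0. Qed.
Lemma dm_actN M g : {morph dm_act (d := M) g : x / - x}. Proof. exact: raddfN. Qed.
Lemma dh0 M N (f : dhom M N) : f 0 = 0. Proof. exact: raddf0. Qed.
Lemma dhN M N (f : dhom M N) : {morph f : x / - x}. Proof. exact: raddfN. Qed.
Lemma dhD M N (f : dhom M N) : {morph f : x y / x + y}. Proof. exact: raddfD. Qed.

Lemma dhom_factor (Q B M : dmod p K) (phi : dhom Q B) (psi : dhom Q M) :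
    (forall q, phi q = 0 -> psi q = 0) -> (forall b, exists q, phi q = b) ->
  exists g : dhom B M, forall q, g (phi q) = psi q.
Proof.
move=> ker surj; have /choice[s sK] : forall b, exists q, phi q = b by [].
have E q : psi (s (phi q)) = psi q.
  by apply/eqP; rewrite -subr_eq0 -dhB ker // dhB sK subrr.
have gB : {morph (fun b => psi (s b)) : x y / x - y}.
  by move=> x y; rewrite -dhB -[RHS]E dhB !sK.
have gA h x : psi (s (dm_act h x)) = dm_act h (psi (s x)).
  by rewrite -dh_act -[RHS]E dh_act sK.
by exists (DHom gB gA).
Qed.

(** Here [phi] may have a kernel: [psi] factors through the image of [phi], a submodule of B. In
    this form, differentials and sums of two maps can serve as [phi]. *)
Lemma injective_extend (Q B M : dmod p K) (phi : dhom Q B) (psi : dhom Q M) :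
    injective_dmod M -> (forall q, phi q = 0 -> psi q = 0) ->
  exists g : dhom B M, forall q, g (phi q) = psi q.
Proof.
move=> injM ker.
pose S : {pred B} := fun b => `[< exists q, phi q = b >].
have Sc : zmod_closed S.
  split=> [|_ _ /asboolP[x <-] /asboolP[y <-]]; apply/asboolP.
    by exists 0; rewrite raddf0.
  by exists (x - y); rewrite raddfB.
have Sst g x : x \in S -> dm_act g x \in S.
  by move=> /asboolP[q <-]; apply/asboolP; exists (dm_act g q); rewrite dh_act.
have Sq q : phi q \in S by apply/asboolP; exists q.
pose f q : sub_dmod Sc Sst := Sub (phi q) (Sq q).
have fB : {morph f : x y / x - y} by move=> x y; apply: val_inj; rewrite /= raddfB.
have fA g x : f (dm_act g x) = dm_act g (f x).
  by apply: val_inj; rewrite /= dh_act.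
have [q /(congr1 val)/ker // | b | u uE] :=
  @dhom_factor Q (sub_dmod Sc Sst) M (DHom fB fA) psi.
  by have /asboolP[q qb] := valP b; exists q; apply: val_inj.
have [g gE] := injM _ _ (sub_dm_incl Sc Sst) u val_inj.
by exists g => q; rewrite -uE -[RHS]gE.
Qed.

Lemma injective_sum M N :
  injective_dmod M -> injective_dmod N -> injective_dmod (sum_dmod M N).
Proof.
move=> iM iN A B i f ii.
have [g gE] := iM _ _ i (dcomp (@dfst M N) f) ii.
have [h hE] := iN _ _ i (dcomp (@dsnd M N) f) ii.
by exists (dpair g h) => x; rewrite /= gE hE /=; case: (f x).
Qed.

End Modules.

(** * Contractions, mapping cones and quasi-isomorphisms *)

Section Complexes.
Variables (p : nat) (K : preTopGroupType).
Implicit Types C D E I : complex p K.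

Definition cx_exact E : Prop := forall n (x : E (n + 1)),
  cx_d E (n + 1) x = 0 -> exists y, x = cx_d E n y.

Lemma int_shift (P : int -> Prop) : (forall n, P (n + 1)) -> forall n, P n.
Proof. by move=> h n; have := h (n - 1); rewrite subrK. Qed.

Lemma int_ind_ge (P : int -> Prop) (n0 : int) : (forall n, n < n0 -> P n) ->
  (forall n, P n -> P (n + 1)) -> forall n, P n.
Proof.
move=> h0 hS n; have [/h0//|] := ltP n n0; rewrite -subr_ge0.
case E : (n - n0) => [k|] // _.
have -> : n = n0 + k%:Z by rewrite -E addrC subrK.
elim: k {E} => [|k IH]; last by rewrite -addn1 PoszD addrA; exact: hS.
by rewrite addr0; have := hS (n0 - 1); rewrite subrK; apply; apply: h0; lia.
Qed.

(* By induction on n, there is a projection r of E n onto its cycles; as 1 - r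
   factors through d, injectivity of E n provides s, and d s is a projection of
   E (n + 1) onto its cycles. *)
Lemma contracting E : cx_exact E -> dplus_object E ->
  forall n, exists s : dhom (E (n + 1)) (E n),
    forall x, cx_d E (n + 1) x = 0 -> cx_d E n (s x) = x.
Proof.
move=> exE [[n0 E0] injE].
have step n (r : dhom (E n) (E n)) : (forall x, cx_d E n (r x) = 0) ->
    (forall x, cx_d E n x = 0 -> r x = x) ->
    exists s : dhom (E (n + 1)) (E n),
    forall x, cx_d E (n + 1) x = 0 -> cx_d E n (s x) = x.
  move=> r0 rid.
  have [q dq | s sE] := @injective_extend _ _ (E n) _ _ (cx_d E n)
    (dsub (did _) r) (injE n); first by rewrite /= rid // subrr.
  by exists s => x /exE[y ->]; rewrite sE /= dhB r0 subr0.
suff R n : exists r : dhom (E n) (E n), (forall x, cx_d E n (r x) = 0) /\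
    (forall x, cx_d E n x = 0 -> r x = x).
  by move=> n; have [r [r0 rid]] := R n; exact: (step n r).
move: n; apply: (int_ind_ge (n0 := n0)) => [n ltn|n [r [r0 rid]]].
  by exists (zero_hom _ _); split=> [x|x _]; rewrite /= ?dh0 // [x]E0.
have [s sE] := step _ _ r0 rid; exists (dcomp (cx_d E n) s).
by split=> x; [rewrite /= cx_dd | exact: sE].
Qed.

Section Cone.
Variables (C D : complex p K) (f : chain_map C D).
Definition cone_obj n : dmod p K := sum_dmod (C (n + 1)) (D n).
Definition cone_d n : dhom (cone_obj n) (cone_obj (n + 1)) :=
  dpair (dsub (zero_hom _ _) (dcomp (cx_d C (n + 1)) (@dfst _ _ _ _)))
    (dcopair (f (n + 1)) (cx_d D n)).
Fact cone_dd n x : cone_d (n + 1) (cone_d n x) = 0.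
Proof.
rewrite /= !sub0r !dhN dhD /= cx_dd oppr0 !cm_d cx_dd addr0 addNr.
by rewrite oppr0.
Qed.
Definition cone : complex p K := Complex cone_dd.

(** A cycle (c, y) satisfies f c = - d y, so c = d z by injectivity on cohomology. Then f z + y is a
    cycle, equal to f x + d w with x a cycle by surjectivity, and (x - z, w) is a primitive. *)
Lemma cone_exact : quasi_iso f -> cx_exact cone.
Proof.
move=> qi n [c y] /= [] /eqP; rewrite sub0r oppr_eq0 => /eqP dc fc.
have [inj surj] := qi (n + 1).
have [|z cz] := inj c dc.
  by exists (- y); rewrite dhN; apply/eqP; rewrite -addr_eq0 fc.
have [|x [dx [w fzy]]] := (qi n).2 (f _ z + y).
  by rewrite dhD -cm_d -cz.
exists (x - z, w) => /=; rewrite sub0r dhB dx sub0r opprK -cz dhB.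
by congr pair; rewrite addrAC -fzy addrAC subrr add0r.
Qed.

Lemma cone_dplus : dplus_object C -> dplus_object D -> dplus_object cone.
Proof.
move=> [[m C0] iC] [[n D0] iD]; split=> [|k]; last exact: injective_sum.
exists (Order.min (m - 1) n) => k; rewrite lt_min ltrBrDr => /andP[km kn] [x y].
by rewrite [x]C0 // [y]D0.
Qed.
End Cone.

Lemma inv_dhom (L : preTopGroupType) (q : qmap K L) (M N : dmod p K)
  (s : dhom M N) x : x \in inv_pred q M -> s x \in inv_pred q N.
Proof. by move=> /asboolP h; apply/asboolP => g /h; rewrite -dh_act => ->. Qed.

Definition inv_elt (L : preTopGroupType) (q : qmap K L) (M : dmod p K) x
  (xI : x \in inv_pred q M) : inv_dmod q M := (Sub x xI : inv_sort q M).

Definition inv_map (L : preTopGroupType) (q : qmap K L) C D (f : chain_map C D) :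
  chain_map (invC q C) (invC q D).
Proof.
exists (fun n => inv_hom q (f n)) => n x.
by apply: val_inj; rewrite /= cm_d.
Defined.

(** The contraction of the cone is equivariant, so an invariant cycle has an invariant primitive.
    This is applied to (0, y) for surjectivity and to (x, - y), where f x = d y, for injectivity. *)
Lemma inv_quasi_iso (L : preTopGroupType) (q : qmap K L) C D (f : chain_map C D) :
  dplus_object C -> dplus_object D -> quasi_iso f -> quasi_iso (inv_map q f).
Proof.
move=> dC dD qi.
have S := contracting (cone_exact qi) (cone_dplus f dC dD).
move=> n; split; last first.
  move=> y /(congr1 val) /= dy; have [s sE] := S n.
  have := sE (0, val y); rewrite /= !dh0 subr0 add0r dy => /(_ erefl).
  set cw := s _ => -[] /eqP; rewrite sub0r oppr_eq0 => /eqP dc fcw.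
  have cwI : cw \in inv_pred q (sum_dmod (C (n + 1)) (D n)).
    apply: inv_dhom; have /asboolP hy := valP y; apply/asboolP => g /hy.
    by rewrite /= /sum_act /= dm_act0 => ->.
  have c1 := inv_dhom (@dfst _ _ _ _) cwI; have c2 := inv_dhom (@dsnd _ _ _ _) cwI.
  exists (inv_elt c1); split; first exact: val_inj.
  by exists (inv_elt c2); apply: val_inj.
(* After the shift (x, - y) lies in degree n + 1 of the cone, where [S n] applies. *)
move: n; apply: int_shift => n x /(congr1 val) /= dx [y /(congr1 val) /= fx].
have [s sE] := S n.
have := sE (val x, - val y); rewrite /= dhN fx dx !subrr => /(_ erefl).
set cw := s _ => -[e _].
have cwI : cw \in inv_pred q (sum_dmod (C (n + 1)) (D n)).
  apply: inv_dhom; have /asboolP hy := valP y; have /asboolP hx := valP x.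
  by apply/asboolP => g g1; rewrite /= /sum_act /= dm_actN hx ?hy.
have c1 := inv_dhom (@dfst _ _ _ _) cwI.
exists (- inv_elt c1); apply: val_inj.
by rewrite /= -e sub0r dhN.
Qed.

Lemma quasi_iso_bij C D (f : chain_map C D) :
  (forall n, injective (f n)) -> (forall n y, exists x, f n x = y) -> quasi_iso f.
Proof.
move=> inj surj n; split=> [x _ [y]|y dy].
  by have [z <-] := surj _ y; rewrite -cm_d => /inj; exists z.
have [x xy] := surj _ y; exists x; split; last by exists 0; rewrite dh0 addr0.
by apply: (inj); rewrite cm_d xy dy dh0.
Qed.

Section Comp.
Variables (C D E : complex p K) (g : chain_map D E) (f : chain_map C D).
Fact ccomp_d n x :
  dcomp (g (n + 1)) (f (n + 1)) (cx_d C n x) = cx_d E n (dcomp (g n) (f n) x).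
Proof. by rewrite /= !cm_d. Qed.
Definition ccomp : chain_map C E := ChainMap ccomp_d.

Lemma quasi_iso_comp : quasi_iso f -> quasi_iso g -> quasi_iso ccomp.
Proof.
move=> qf qg n; split=> [x dx [y fxy]|y dy].
  have [|z xz] := (qg n).1 (f _ x) _ (ex_intro _ y fxy).
    by rewrite -cm_d dx dh0.
  by apply: (qf n).1 => //; exists z.
have [x [dx [w yE]]] := (qg n).2 y dy.
have [z [dz [v xE]]] := (qf n).2 x dx.
exists z; split=> //; exists (g n v + w).
by rewrite yE xE !dhD /= cm_d addrA.
Qed.

Lemma quasi_iso_left : quasi_iso f -> quasi_iso ccomp -> quasi_iso g.
Proof.
move=> qf qc n; split=> [x dx [y gxy]|y dy].
  have [z [dz [v xE]]] := (qf n).2 x dx.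
  have [|w zw] := (qc n).1 z dz.
    exists (y - g n v); rewrite dhB -cm_d -gxy xE dhD /=.
    by rewrite addrK.
  by exists (f n w + v); rewrite dhD -cm_d -zw.
have [x [dx [w yE]]] := (qc n).2 y dy.
by exists (f _ x); split; [rewrite -cm_d dx dh0 | exists w].
Qed.
End Comp.

Definition cid_map C : chain_map C C := @ChainMap _ _ C C (fun n => did _) (fun _ _ => erefl).

Lemma quasi_iso_dplus_equiv C D (f : chain_map C D) :
  dplus_object D -> quasi_iso f -> dplus_equiv C D.
Proof.
move=> dD qf; exists D; split; first by split=> //; exists f.
split=> //; exists (cid_map D); apply: quasi_iso_bij => [n x y //|n y].
by exists y.
Qed.

End Complexes.

(** * Extending chain maps along injective quasi-isomorphisms *)

Section Lifting.
Variables (p : nat) (K : preTopGroupType) (C D I : complex p K).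
Variables (s : chain_map C D) (g : chain_map C I).
Hypotheses (s_inj : forall n, injective (s n)) (s_qi : quasi_iso s).
Hypothesis I_dplus : dplus_object I.

(* The maps are built degree by degree, as total families compatible with the
   differentials up to some degree, to avoid dependent recursion. *)
Let family := forall n, dhom (D n) (I n).

Definition lift_upto (N : int) (h : family) : Prop :=
  (forall n x, n <= N -> h (n + 1) (cx_d D n x) = cx_d I n (h n x)) /\
  (forall n x, n <= N + 1 -> h n (s n x) = g n x).

(** The new component extends (g, d h) along (s, d), defined on the sum of C and D. If s c + d y =
    0, then c = d z and s z + y = s x + d w with x a cycle, so that d h y = d g (x - z) = - g c: the
    kernel condition holds. *)
Lemma lift_step N h : lift_upto N h ->
  exists h', lift_upto (N + 1) h' /\ forall n, n <= N + 1 -> h' n = h n.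
Proof.
move=> [hd hs].
have [|u uE] := @injective_extend _ _ _ _ (I (N + 1 + 1))
    (dcopair (s (N + 1 + 1)) (cx_d D (N + 1)))
    (dcopair (g (N + 1 + 1)) (dcomp (cx_d I (N + 1)) (h (N + 1))))
    (I_dplus.2 _).
  move=> [c y] /= sc; have sc' : s _ c = - cx_d D (N + 1) y.
    by apply/eqP; rewrite -addr_eq0 sc.
  have dc : cx_d C _ c = 0.
    by apply: s_inj; rewrite cm_d sc' dhN cx_dd oppr0 dh0.
  have [|z cz] := (s_qi (N + 1)).1 c dc; first by exists (- y); rewrite dhN.
  have [|x [dx [w yE]]] := (s_qi N).2 (s _ z + y).
    by rewrite dhD -cm_d -cz.
  have -> : y = s _ (x - z) + cx_d D N w.
    by rewrite dhB addrAC -yE addrAC subrr add0r.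
  rewrite dhD hs // hd // dhD cx_dd addr0 dhB dhB -!cm_d dx dh0 sub0r cz.
  by rewrite subrr.
pose h' := @eqtype.dfwith _ _ h (N + 1 + 1) u.
have h'E n : n <= N + 1 -> h' n = h n.
  by move=> le; rewrite /h' eqtype.dfwith_out //; apply/eqP; lia.
have h'2 : h' (N + 1 + 1) = u by rewrite /h' eqtype.dfwith_in.
exists h'; split=> //; split=> n x.
  rewrite le_eqVlt => /orP[/eqP nN|lt]; last by rewrite !h'E ?hd //; lia.
  by rewrite {n}nN in x *; rewrite h'2 h'E //; have := uE (0, x); rewrite /= !dh0 !add0r.
rewrite le_eqVlt => /orP[/eqP nN|lt]; last by rewrite h'E ?hs //; lia.
by rewrite {n}nN in x *; rewrite h'2; have := uE (x, 0); rewrite /= !dh0 !addr0.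
Qed.

Lemma lift_chain_map : exists h : chain_map D I, forall n x, h n (s n x) = g n x.
Proof.
(* I vanishes up to degree n0 - 1 = N0 + 1, so the zero family satisfies [lift_upto N0]. *)
have [[n0 I0] _] := I_dplus; have [N0 N0E] : exists N0, N0 = n0 - 2 by exists (n0 - 2).
pose good k := lift_upto (N0 + k%:Z).
have /choice[next nextP] (kh : nat * family) : exists h', good kh.1 kh.2 ->
    good kh.1.+1 h' /\ forall n, n <= N0 + kh.1%:Z + 1 -> h' n = kh.2 n.
  have [/lift_step[h' h'P]|] := pselect (good kh.1 kh.2); last by exists kh.2.
  by exists h' => _; rewrite /good -addn1 PoszD addrA.
pose F := fix F k : family := if k is k'.+1 then next (k', F k') else fun n => zero_hom _ _.
have gF k : good k (F k).
  elim: k => [|k /(nextP (k, _))[]//].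
  by split=> n x le /=; rewrite ?dh0 // [RHS]I0 //; lia.
have FS k j n : n <= N0 + k%:Z + 1 -> F (k + j)%N n = F k n.
  move=> le; elim: j => [|j IH]; first by rewrite addn0.
  rewrite addnS /= (nextP (_, _) (gF _)).2 //=; lia.
(* The component of degree n is stationary from this index on, so the diagonal family inherits all
   the compatibilities. *)
pose H n := F `|n - N0|%N n.
have HE k n : n <= N0 + k%:Z + 1 -> H n = F k n.
  move=> le; case: (leqP k `|n - N0|%N) => [kn|/ltnW kn].
    by rewrite /H -(subnKC kn) FS.
  by rewrite -(subnKC kn) FS //; lia.
have Hd n x : H (n + 1) (cx_d D n x) = cx_d I n (H n x).
  rewrite !(@HE `|n - N0|%N); try lia.
  by apply: (gF _).1; lia.
exists (ChainMap Hd) => n x; apply: (gF _).2; lia.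
Qed.

End Lifting.

(** * Invariants and twists preserve injectives *)

Section InvariantsInjective.
Variables (p : nat) (K L : preTopGroupType) (q : qmap K L).

(** Invariants under the kernel of q are right adjoint to inflation along q, which preserves
    injections. *)
Lemma injective_inv (M : dmod p K) : injective_dmod M -> injective_dmod (inv_dmod q M).
Proof.
move=> injM A B i f ii.
have fB : {morph (fun x : res_dmod q A => val (f x)) : x y / x - y}.
  by move=> x y; rewrite dhB.
have fA g (x : res_dmod q A) : val (f (dm_act g x)) = dm_act g (val (f x)).
  exact: etrans (congr1 val (dh_act f (q g) x)) (inv_actE _ _).
have [u uE] := injM (res_dmod q A) (res_dmod q B) (res_hom q i) (DHom fB fA) ii.
have uI x : u x \in inv_pred q M.
  by apply/asboolP => g g1; rewrite -dh_act /= g1 dm_act1.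
pose v (x : B) : inv_dmod q M := inv_elt (uI x).
have vB : {morph v : x y / x - y} by move=> x y; apply: val_inj; rewrite /= dhB.
have vA g x : v (dm_act g x) = dm_act g (v x).
  have [h <-] := qmap_surj q g; apply: val_inj.
  transitivity (dm_act h (u x)); first exact: (dh_act u h (x : res_dmod q B)).
  exact/esym/inv_actE.
by exists (DHom vB vA) => x; apply: val_inj; exact: uE.
Qed.

Lemma inv_dplus (C : complex p K) : dplus_object C -> dplus_object (invC q C).
Proof.
move=> [[n0 C0] iC]; split=> [|n]; last exact: injective_inv.
by exists n0 => n /C0 h x; apply: val_inj; exact: h.
Qed.

End InvariantsInjective.

Section Twisting.
Variables (p : nat) (pr : prime p) (K : preTopGroupType).

Lemma char_expV (th : character pr K) g : char_exp th (-1) g * th g = 1.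
Proof. by rewrite /= exprN1 mulVr // char_unit. Qed.

(** A morphism A -> M{th} is the same function as a morphism A{th^-1} -> M. *)
Lemma injective_twist (th : character pr K) (M : dmod p K) :
  injective_dmod M -> injective_dmod (twist_dmod th M).
Proof.
move=> injM A B i f ii; pose th' := char_exp th (-1).
have fA g (x : twist_dmod th' A) : f (dm_act g x) = dm_act (d := M) g (f x).
  rewrite /= /tw_act (padic_act_additive _ (@dm_primary _ _ (twist_dmod th M)) f) /=.
  by rewrite dh_act /= /tw_act -padic_actM char_expV padic_act1.
have [u uE] := injM (twist_dmod th' A) (twist_dmod th' B) (twist_hom th' i)
  (@DHom _ _ (twist_dmod th' A) M f (dhB f) fA) ii.
have uA g (x : B) : u (dm_act g x) = dm_act (d := twist_dmod th M) g (u x).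
  rewrite /= /tw_act -dh_act -(padic_act_additive (@dm_primary _ _ (twist_dmod th' B)) _ u).
  by rewrite /= /tw_act -padic_actM mulrC char_expV padic_act1.
by exists (@DHom _ _ B (twist_dmod th M) u (dhB u) uA).
Qed.

Lemma twist_dplus (th : character pr K) (C : complex p K) :
  dplus_object C -> dplus_object (twistC th C).
Proof. by move=> [C0 iC]; split=> // n; exact: injective_twist. Qed.

Definition twist_map (th : character pr K) (C D : complex p K) (f : chain_map C D) :
    chain_map (twistC th C) (twistC th D) :=
  @ChainMap _ _ (twistC th C) (twistC th D) (fun n => twist_hom th (f n)) (cm_d f).

(** Only the action changes, while [quasi_iso] speaks of the underlying groups and differentials. *)
Lemma twist_quasi_iso (th : character pr K) (C D : complex p K) (f : chain_map C D) :
  quasi_iso f -> quasi_iso (twist_map th f).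
Proof. exact. Qed.

Section Degree0.
Variables (th : character pr K) (M : dmod p K).

Definition twist_deg0_hom (b : bool) :
    dhom (if b then twist_dmod th M else zero_dmod p K)
         (twist_dmod th (if b then M else zero_dmod p K)) :=
  if b as b return dhom (if b then twist_dmod th M else zero_dmod p K)
         (twist_dmod th (if b then M else zero_dmod p K))
  then did _ else zero_hom _ _.

Definition twist_deg0 :
  chain_map (in_degree0 (twist_dmod th M)) (twistC th (in_degree0 M)).
Proof.
exists (fun n : int => twist_deg0_hom (n == 0)) => n x.
by rewrite /= dh0.
Defined.

Lemma twist_deg0_quasi_iso : quasi_iso twist_deg0.
Proof.
apply: quasi_iso_bij => n /=; case: (n == 0) => //=.
- by move=> x y _; rewrite [x]ord1 [y]ord1.
- by move=> y; exists y.
- by move=> y; exists 0; rewrite [RHS]ord1.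
Qed.
End Degree0.

Lemma in_degree0_inj (M : dmod p K) (C : complex p K) (f : chain_map (in_degree0 M) C) :
  quasi_iso f -> forall n, injective (f n).
Proof.
move=> qf; apply: int_shift => n x y fxy; apply/eqP; rewrite -subr_eq0; apply/eqP.
have [//||z -> //] := (qf n).1 (x - y).
by exists 0; rewrite dhB fxy subrr dh0.
Qed.

(** Since [in_degree0 M] has zero differentials, f is injective in each degree and g lifts along it
    to h with h f = g; two out of three then applies. *)
Lemma resolution_comparison (M : dmod p K) (I J : complex p K)
    (f : chain_map (in_degree0 M) I) (g : chain_map (in_degree0 M) J) :
  quasi_iso f -> quasi_iso g -> dplus_object J ->
  exists h : chain_map I J, quasi_iso h.
Proof.
move=> qf qg dJ; have [h hE] := lift_chain_map g (in_degree0_inj qf) qf dJ.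
exists h; apply: (quasi_iso_left (f := f)) => // n.
have [gi gs] := qg n; split=> [x dx [y]|y /gs[x [dx [z ->]]]].
  by rewrite /= hE => e; apply: gi => //; exists y.
by exists x; split=> //; exists z; rewrite /= hE.
Qed.

End Twisting.

(** * Q(mu_{p^n}) is unramified outside p *)

Section FrobeniusFixed.
Local Open Scope algC_scope.

Lemma eqAmod_Frobenius (l : nat) (x y : algC) : prime l -> x \in Aint -> y \in Aint ->
  ((x + y) ^+ l == x ^+ l + y ^+ l %[mod l])%A.
Proof.
move=> pr xA yA; have l0 := prime_gt0 pr.
rewrite exprDn -(prednK l0) big_ord_recl big_ord_recr /= !prednK //.
rewrite subn0 expr0 mulr1 bin0 mulr1n /bump leq0n add1n prednK // subnn expr0 mul1r binn.
rewrite mulr1n addrCA -[X in (_ == X %[mod _])%A]add0r eqAmodDr eqAmod0.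
apply: rpred_sum => i _; rewrite -mulr_natl.
have /dvdnP[k ->] : (l %| 'C(l, bump 0 i))%N.
  by apply: prime_dvd_bin => //; rewrite /bump leq0n add1n -ltn_predRL ltn_ord.
rewrite -eqAmod0 natrM mulrAC eqAmodMl0 //.
by rewrite !rpredM ?rpredX ?rpred_nat.
Qed.

Variables (l : nat) (pr : prime l) (f : nat).

Lemma eqAmod_Frobenius_iter x y : x \in Aint -> y \in Aint ->
  ((x + y) ^+ (l ^ f) == x ^+ (l ^ f) + y ^+ (l ^ f) %[mod l])%A.
Proof.
move=> xA yA; elim: f => [|k IH]; first by rewrite expn0 !expr1.
have X z m n : z \in Aint -> (z == n %[mod l])%A -> n \in Aint ->
    (z ^+ m == n ^+ m %[mod l])%A.
  move=> zA zn nA; elim: m => [|m IHm]; first by rewrite !expr0.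
  by rewrite !exprS eqAmodM ?rpredX.
rewrite expnSr !exprM.
apply: eqAmod_trans (X _ l _ _ IH _) _; rewrite ?rpredX ?rpredD ?rpredX //.
by apply: eqAmod_Frobenius; rewrite ?rpredX.
Qed.

(* The proof of primality makes the subring structure inferable. *)
Definition frob_fixed of prime l : {pred algC} :=
  fun x => (x \in Aint) && (x ^+ (l ^ f) == x %[mod l])%A.

Fact frob_fixed_closed : subring_closed (frob_fixed pr).
Proof.
have D x y : x \in frob_fixed pr -> y \in frob_fixed pr -> x + y \in frob_fixed pr.
  move=> /andP[xA xl] /andP[yA yl]; rewrite unfold_in rpredD //=.
  by apply: eqAmod_trans (eqAmod_Frobenius_iter xA yA) _; rewrite eqAmodD.
have lf0 : (0 < l ^ f)%N by rewrite expn_gt0 prime_gt0.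
(* Expanding (x - x)^q = 0 modulo l gives (- x)^q = - x^q, for l = 2 as well as for odd l. *)
have N x : x \in frob_fixed pr -> - x \in frob_fixed pr.
  move=> /andP[xA xl]; rewrite unfold_in rpredN xA /=.
  have := eqAmod_Frobenius_iter xA (rpredNr xA).
  rewrite subrr expr0n -[_ == _]negbK -lt0n lf0 /= => h.
  rewrite -(eqAmodDl _ (x ^+ (l ^ f))); apply: eqAmod_trans.
    by rewrite eqAmod_sym; exact: h.
  by rewrite eqAmod_sym /eqAmod subr0; exact: xl.
split=> [|x y xS yS|x y /andP[xA xl] /andP[yA yl]].
- by rewrite unfold_in rpred1 expr1n /=.
- by apply: D => //; apply: N.
by rewrite unfold_in rpredM //= exprMn eqAmodM ?rpredX.
Qed.
HB.instance Definition _ := GRing.isSubringClosed.Build algC (frob_fixed pr)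
  frob_fixed_closed.

(** As N^q = N modulo l, the congruence for N x says that l divides N (x^q - x); a Bezout relation
    between N and l removes the factor N. *)
Lemma frob_fixed_divisible (N : nat) x : coprime l N -> x \in Aint ->
  N%:R * x \in frob_fixed pr -> x \in frob_fixed pr.
Proof.
move=> co xA /andP[_ Nx]; rewrite unfold_in xA /=.
have /andP[_ NN] : N%:R \in frob_fixed pr by rewrite rpred_nat.
set q := (l ^ f)%N in Nx NN *.
have N0 : (0 < N)%N.
  by rewrite lt0n; apply: contraTneq co => ->; rewrite /coprime gcdn0; case: l pr => [|[]].
have H : (N%:R * (x ^+ q - x) == 0 %[mod l])%A.
  rewrite mulrBr eqAmod0 -/(eqAmod _ _ _); apply: eqAmod_trans Nx.
  by rewrite eqAmod_sym exprMn eqAmodMr ?rpredX.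
case: (egcdnP l N0) => u v e _; rewrite gcdnC (eqP co) in e.
rewrite /eqAmod -eqAmod0.
have -> : x ^+ q - x = u%:R * (N%:R * (x ^+ q - x)) - v%:R * (x ^+ q - x) * l%:R.
  by rewrite mulrA -natrM e natrD natrM; ring.
rewrite -[X in (_ == X %[mod _])%A](subrr 0) eqAmodD //.
  by rewrite -(mulr0 u%:R) eqAmodMl ?rpred_nat.
by rewrite eqAmodN !oppr0 eqAmodMl0 // rpredM ?rpredB ?rpredX ?rpred_nat.
Qed.

End FrobeniusFixed.

(** * Traces and integers of Q(mu_{p^n}) *)

Section CyclotomicIntegers.

Lemma sum_multiples (V : nmodType) (q k : nat) (F : nat -> V) : (0 < q)%N ->
  \sum_(a < q * k | (q %| a)%N) F a = \sum_(b < k) F (q * b)%N.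
Proof.
move=> q0.
have h1 (b : 'I_k) : (q * b < q * k)%N by rewrite ltn_pmul2l.
have h2 (a : 'I_(q * k)) : (a %/ q < k)%N by rewrite ltn_divLR // [X in (_ < X)%N]mulnC.
rewrite (reindex_onto (fun b => Ordinal (h1 b)) (fun a => Ordinal (h2 a))) /=.
  apply: eq_bigl => b; rewrite dvdn_mulr //=; apply/eqP/val_inj => /=.
  by rewrite mulKn.
by move=> a qa; apply: val_inj; rewrite /= mulnC divnK.
Qed.

Lemma geometric_Crat (N : nat) (w : algC) : w ^+ N = 1 -> \sum_(a < N) w ^+ a \in Crat.
Proof.
move=> wN; have [->|w1] := eqVneq w 1.
  by apply: rpred_sum => i _; rewrite expr1n Crat1.
have : (w - 1) * \sum_(a < N) w ^+ a = 0 by rewrite -subrX1 wN subrr.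
by move/eqP; rewrite mulf_eq0 subr_eq0 (negPf w1) => /eqP ->; exact: Crat0.
Qed.

(** These Ramanujan sums are the traces of the powers of a primitive root. For n > 0 each is the
    geometric sum over all a minus the one over the multiples of p. *)
Lemma Ramanujan_Crat (p n : nat) (w : algC) : prime p -> w ^+ (p ^ n) = 1 ->
  \sum_(a < p ^ n | coprime a (p ^ n)) w ^+ a \in Crat.
Proof.
move=> pr; case: n => [|n] wN.
  apply: rpred_sum => a _; have -> : w = 1 by rewrite -[w]expr1 -wN expn0.
  by rewrite expr1n Crat1.
have E : \sum_(a < p ^ n.+1) w ^+ a =
    \sum_(a < p ^ n.+1 | (p %| a)%N) w ^+ a +
    \sum_(a < p ^ n.+1 | coprime a (p ^ n.+1)) w ^+ a.
  rewrite (bigID (fun a : 'I__ => p %| a)%N) /=; congr (_ + _).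
  by apply: eq_bigl => a; rewrite coprime_pexpr // coprime_sym prime_coprime.
rewrite -[X in X \in _](addKr (\sum_(a < p ^ n.+1 | (p %| a)%N) w ^+ a)) -E addrC.
rewrite rpredB ?geometric_Crat // expnS sum_multiples ?prime_gt0 //.
under eq_bigr do rewrite exprM.
by rewrite geometric_Crat // -exprM -expnS.
Qed.

(* T_j is the trace of x z^-j, and \sum_j T_j z^j = p^n x by orthogonality. *)
Lemma cyclotomic_integers (p n m : nat) (z : algC) (c : 'I_m -> algC) :
    prime p -> (p ^ n).-primitive_root z -> (forall i, c i \in Crat) ->
    let x := \sum_(i < m) c i * z ^+ i in x \in Aint ->
  exists T : 'I_(p ^ n) -> algC, (forall j, T j \in Num.int) /\
    (p ^ n)%:R * x = \sum_j T j * z ^+ j.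
Proof.
move=> pr zP cQ x xA; set N := (p ^ n)%N.
have N0 : (0 < N)%N by rewrite expn_gt0 prime_gt0.
have zA : z \in Aint by exact: Aint_prim_root zP.
have zN : z ^+ N = 1 := prim_expr_order zP.
have z0 : z != 0.
  by apply/eqP => z00; move/eqP: zN; rewrite z00 expr0n eqn0Ngt N0 eq_sym oner_eq0.
have zVN : z^-1 ^+ N = 1 by rewrite exprVn zN invr1.
have zVA : z^-1 \in Aint.
  by apply: (Aint_unity_root N0); apply/unity_rootP.
have /choice[s sP] (a : 'I_N) : exists u : {rmorphism algC -> algC},
    coprime a N -> forall y, y ^+ N = 1 -> u y = y ^+ a.
  have [co|nco] := boolP (coprime a N); last by exists idfun.
  by have [u uP] := Qn_aut_exists co; exists u.
pose T (j : 'I_N) := \sum_(a < N | coprime a N) s a (x * z^-1 ^+ j).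
exists T; split.
  move=> j; apply: Cint_rat_Aint; last first.
    by apply: rpred_sum => a _; rewrite Aint_aut rpredM ?rpredX.
  have -> : T j = \sum_(i < m) c i * \sum_(a < N | coprime a N) (z ^+ i * z^-1 ^+ j) ^+ a.
    under [RHS]eq_bigr do rewrite mulr_sumr.
    rewrite exchange_big; apply: eq_bigr => a co.
    rewrite mulr_suml rmorph_sum; apply: eq_bigr => i _.
    rewrite -mulrA rmorphM aut_Crat //; congr (_ * _); apply: sP => //.
    by rewrite exprMn -!exprM ![(_ * N)%N]mulnC !exprM zN zVN !expr1n mulr1.
  apply: rpred_sum => i _; apply: rpredM => //; apply: Ramanujan_Crat => //.
  by rewrite exprMn -!exprM ![(_ * p ^ n)%N]mulnC !exprM zN zVN !expr1n mulr1.
transitivity (\sum_(a < N | coprime a N) s a x * \sum_(j < N) (z^-1 ^+ a * z) ^+ j); last first.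
  under [RHS]eq_bigr do rewrite mulr_suml.
  rewrite [RHS]exchange_big; apply: eq_bigr => a co /=.
  rewrite mulr_sumr; apply: eq_bigr => j _.
  rewrite rmorphM -mulrA; congr (_ * _); rewrite rmorphXn /= (sP a co z^-1) //.
  by rewrite exprMn.
(* The exponent of the identity is 1 reduced mod N, that is, 0 when N = 1. *)
pose a1 : 'I_N := Ordinal (ltn_pmod 1 N0).
have a1co : coprime a1 N by rewrite /= coprime_modl coprime1n.
rewrite (bigD1 a1) //= [X in _ + X]big1 ?addr0.
  have za1 : z ^+ a1 = z by rewrite /= prim_expr_mod.
  have -> : s a1 x = x.
    rewrite rmorph_sum; apply: eq_bigr => i _.
    by rewrite rmorphM rmorphXn /= aut_Crat // (sP a1) // za1.
  rewrite exprVn za1 mulVf // mulrC; congr (_ * _).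
  by under eq_bigr do rewrite expr1n; rewrite sumr_const card_ord.
move=> a /andP[co aa1]; set w := z^-1 ^+ a * z.
have w1 : w != 1.
  apply: contra aa1 => /eqP w1; apply/eqP/val_inj => /=.
  rewrite -(modn_small (ltn_ord a)); apply/eqP.
  rewrite -(eq_prim_root_expr zP) expr1; apply/eqP.
  by rewrite -[LHS]mulr1 -w1 /w exprVn mulrA divff ?mul1r // expf_neq0.
have wN : w ^+ N = 1.
  by rewrite exprMn zN mulr1 -exprM mulnC exprM zVN expr1n.
have : (w - 1) * \sum_(j < N) w ^+ j = 0 by rewrite -subrX1 wN subrr.
by move/eqP; rewrite mulf_eq0 subr_eq0 (negPf w1) => /eqP ->; rewrite mulr0.
Qed.

End CyclotomicIntegers.

Section CyclotomicField.
Variables (p n : nat) (z : algC).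
Hypotheses (pr : prime p) (zP : (p ^ n).-primitive_root z).

Lemma cyclotomic_field : exists K : {pred algC}, [/\ number_field K, z \in K &
  forall x, x \in K -> exists m (c : 'I_m -> algC),
    (forall i, c i \in Crat) /\ x = \sum_(i < m) c i * z ^+ i].
Proof.
have [Q [QC [[|z1 [|? ?]] //= [zE] gen]]] := num_field_exists [:: z].
pose K : {pred algC} := fun x => `[< exists y, QC y = x >].
exists K; split.
- split; first split.
  + by apply/asboolP; exists 1; rewrite rmorph1.
  + move=> _ _ /asboolP[x <-] /asboolP[y <-]; apply/asboolP.
    by exists (x - y); rewrite rmorphB.
  + move=> _ _ /asboolP[x <-] /asboolP[y <-]; apply/asboolP.
    by exists (x / y); rewrite fmorph_div.
  exists (map QC (vbasis {:Q})) => _ /asboolP[y <-]; apply/Crat_spanP.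
  rewrite /in_Crat_span size_map size_tuple.
  exists [ffun i => coord (vbasis {:Q}) i y].
  rewrite {1}(coord_vbasis (memvf y)) rmorph_sum; apply: eq_bigr => i _.
  by rewrite ffunE rmorphZ_num (nth_map 0) ?size_tuple.
- by apply/asboolP; exists z1.
move=> _ /asboolP[y <-]; have : y \in <<1; z1>>%VS by rewrite -adjoin_seq1 gen memvf.
case/Fadjoin_polyP => q /polyOverP qQ ->.
exists (size q), (fun i => QC q`_i); split.
  by move=> i; have /vlineP[k ->] := qQ i; rewrite alg_num_field fmorph_rat Crat_rat.
rewrite horner_coef rmorph_sum; apply: eq_bigr => i _.
by rewrite rmorphM rmorphXn /= zE.
Qed.

(** By Euler's theorem the exponent l^f, with f the totient of p^n, is 1 mod p^n; hence it fixes z,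
    and Z[z] lies in the subring [frob_fixed]. It contains p^n x, and p^n is prime to l. *)
Lemma frobenius_cyclotomic (K : {pred algC}) (l : nat) (lP : prime l) x :
    (forall x, x \in K -> exists m (c : 'I_m -> algC),
      (forall i, c i \in Crat) /\ x = \sum_(i < m) c i * z ^+ i) ->
    l != p -> x \in K -> x \in Aint -> x \in frob_fixed (totient (p ^ n)) lP.
Proof.
move=> KE lp /KE[m [c [cQ xE]]] xA.
have co : coprime l (p ^ n) by apply: coprimeXr; rewrite prime_coprime // dvdn_prime2.
apply: (frob_fixed_divisible co) => //; rewrite xE in xA *.
have [T [TZ ->]] := cyclotomic_integers pr zP cQ xA.
apply: rpred_sum => j _; apply: rpredM.
  by have /intrP[k ->] := TZ j; exact: rpred_int.
apply: rpredX; rewrite unfold_in (Aint_prim_root zP) /=.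
by rewrite -(prim_expr_mod zP (_ ^ _)%N) Euler_exp_totient // (prim_expr_mod zP) expr1.
Qed.

(* If l = sum a_i b_i with a_i, b_i in P, the product U of the 1 - a_i^(q-1) and
   of the 1 - b_i^(q-1) is not in P; but l divides (1 - a_i^(q-1)) a_i and
   (1 - b_i^(q-1)) b_i, so that l^2 divides U l, and U would be in P. *)
Lemma unramified_frobenius (K : {pred algC}) (l f : nat) (lP : prime l) :
    divring_closed K -> (0 < f)%N ->
    (forall x, x \in K -> x \in Aint -> x \in frob_fixed f lP) ->
  unramified_at l K.
Proof.
move=> Kc f0 KF P [[PO P0] PD PM P1 Pp] Pl [s [sP lE]].
have [K1 KB KV] := Kc.
pose O := integers_of K.
have O1 : O 1 by split; rewrite ?rpred1.
have OB x y : O x -> O y -> O (x - y) by move=> [? ?] [? ?]; split; rewrite ?rpredB ?KB.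
have OD x y : O x -> O y -> O (x + y).
  move=> Ox Oy; rewrite -[y]opprK -[- y]sub0r; apply: (OB) => //.
  by apply: (OB) => //; exact: PO.
have KM x y : x \in K -> y \in K -> x * y \in K.
  move=> xK yK; rewrite -[y]invrK; apply: (KV) => //.
  by rewrite -[y^-1]mul1r; apply: (KV).
have OM x y : O x -> O y -> O (x * y) by move=> [? ?] [? ?]; split; rewrite ?rpredM ?KM.
have OX x k : O x -> O (x ^+ k) by move=> Ox; elim: k => // k IH; rewrite exprS; apply: OM.
have PX x k : P x -> P (x ^+ k.+1) by move=> Px; rewrite exprSr; apply: PM => //; apply/OX/PO.
have l0 : l%:R != 0 :> algC by rewrite pnatr_eq0 -lt0n prime_gt0.
set q := (l ^ f)%N.
have q1 : (1 < q)%N by rewrite -(exp1n f) ltn_exp2r // prime_gt1.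
(* The exponent [q'.+1] is q - 1; being positive, it keeps x^(q-1) in P. *)
have [q' qE] : exists q', q = q'.+2 by exists q.-2; case: q q1 => [|[]].
have lK : l%:R \in K by exact: (PO _ Pl).1.
pose u (x : algC) : algC := 1 - x ^+ q'.+1.
have uO x : P x -> O (u x) by move=> /PO Ox; apply: OB => //; apply: OX.
have uP x : P x -> ~ P (u x).
  move=> Px Pu; apply: P1; rewrite -[1](subrK (x ^+ q'.+1)); apply: PD => //.
  exact: PX.
have ul x : P x -> exists t, O t /\ u x * x = l%:R * t.
  move=> Px; have [xK xA] := PO _ Px.
  have /andP[_] := KF x xK xA; rewrite -/q qE eqAmod_sym /eqAmod unfold_in /= (negPf l0) => tA.
  exists ((x - x ^+ q'.+2) / l%:R); split.
    by split=> //; apply: (KV) => //; apply: (KB) => //; apply: (OX _ _ (PO _ Px)).1.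
  by rewrite mulrC [RHS]mulrC divfK // /u mulrBr mulr1 -exprS.
have [U [OU NU UE]] : exists U, [/\ O U, ~ P U &
    exists t, O t /\ U * (\sum_(ab <- s) ab.1 * ab.2) = l%:R ^+ 2 * t].
  elim: s sP {lE} => [_|[a b] s IH sP].
    exists 1; split=> //; exists 0; split; last by rewrite big_nil !mulr0.
    exact: PO.
  have [] := IH; first by move=> ab abs; apply: sP; rewrite inE abs orbT.
  move=> U [OU NU [t [Ot UE]]].
  have [Pa Pb] : P a /\ P b by apply: (sP (a, b)); rewrite inE eqxx.
  have [ta [Ota taE]] := ul a Pa; have [tb [Otb tbE]] := ul b Pb.
  have [Oa Ob] := (uO a Pa, uO b Pb).
  exists (u a * u b * U); split; first exact: (OM _ _ (OM _ _ Oa Ob) OU).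
    by case/Pp => //; [exact: OM | case/Pp => //; [exact: (uP a) | exact: (uP b)]].
  exists (U * (ta * tb) + u a * u b * t); split.
    by apply: OD; apply: (OM) => //; apply: (OM).
  rewrite big_cons mulrDr -[u a * u b * U * \sum_(j <- s) _]mulrA UE /=.
  transitivity (U * ((u a * a) * (u b * b)) + u a * u b * (l%:R ^+ 2 * t)); first by ring.
  by rewrite taE tbE; ring.
have [t [Ot Ut]] := UE; apply: NU.
have -> : U = t * l%:R by apply: (mulIf l0); rewrite {1}lE Ut; ring.
exact: PM.
Qed.

End CyclotomicField.

Lemma mu_in_QS (p n : nat) (z : algC) : prime p -> (p ^ n).-primitive_root z -> z \in QS_pred p.
Proof.
move=> pr zP; apply: gen_subfield_sub.
have [K [nK zK KE]] := cyclotomic_field z.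
exists K; split=> // l lP lp; apply: (@unramified_frobenius K l (totient (p ^ n)) lP).
- exact: nK.1.
- by rewrite totient_gt0 expn_gt0 prime_gt0.
by move=> x xK xA; exact: (frobenius_cyclotomic pr zP lP KE lp xK xA).
Qed.

(** * Arithmetic of Z_p *)

Section PadicArithmetic.
Variables (p : nat) (pr : prime p).
Local Notation Zp := (padic_int pr).
Implicit Types u v w : Zp.

Lemma residueX u m n : residue (u ^+ m) n = (residue u n ^ m %% p ^ n)%N.
Proof.
elim: m => [|m IH]; first by rewrite expr0 residue1.
by rewrite exprS residueM IH modnMmr -expnS.
Qed.

Lemma residue_nat k n : residue (k%:R : Zp) n = (k %% p ^ n)%N.
Proof.
elim: k => [|k IH]; first by rewrite /residue /= mod0n.
by rewrite -addn1 natrD residueD IH residue1 modnDm.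
Qed.

Lemma residue_mod_p u n : (residue u n.+1 %% p = residue u 1)%N.
Proof. by have := residue_modD u 1 n; rewrite addn1 expn1. Qed.

(** The inverse mod p^n is the power of exponent totient(p^n) - 1; these powers are coherent because
    inverses mod p^n are unique. *)
Lemma padic_unitE u : coprime (residue u 1) p -> u \is a GRing.unit.
Proof.
move=> co.
have con n : coprime (residue u n) (p ^ n).
  case: n => [|n]; first exact: coprimen1.
  by apply: coprimeXr; rewrite -coprime_modl residue_mod_p.
pose f n := (residue u n ^ (totient (p ^ n)).-1)%N.
have fP n : (f n * residue u n = 1 %[mod p ^ n])%N.
  rewrite -expnSr prednK; first exact: Euler_exp_totient.
  by rewrite totient_gt0 expn_gt0 prime_gt0.
have fc n : (f n.+1 = f n %[mod p ^ n])%N.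
  have fP' : (f n.+1 * residue u n = 1 %[mod p ^ n])%N.
    have /eqP := fP n.+1; rewrite -(residueS u n) modnMmr => /eqP e.
    by rewrite -(modn_dvdm _ (dvdn_exp2l p (leqnSn n))) e modn_dvdm ?dvdn_exp2l.
  rewrite -[f n.+1]muln1 -modnMmr -(fP n) modnMmr [(f n * _)%N]mulnC mulnA.
  by rewrite -modnMml fP' modnMml mul1n.
apply/unitrP; exists (padic_of pr fc).
have e : padic_of pr fc * u = 1.
  by apply: residueP => n; rewrite residueM residue_of modnMml fP residue1.
by split; [exact: e | rewrite mulrC].
Qed.

Lemma unit_nat k : coprime k p -> (k%:R : Zp) \is a GRing.unit.
Proof. by move=> co; apply: padic_unitE; rewrite residue_nat expn1 coprime_modl. Qed.

Lemma unit_1_mul_p v : 1 + p%:R * v \is a GRing.unit.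
Proof.
apply: padic_unitE; rewrite residueD residueM residue_nat expn1 modnn mul0n mod0n addn0.
by rewrite residue1 expn1 !coprime_modl coprime1n.
Qed.

Lemma coprime_unit u n : u \is a GRing.unit -> coprime (residue u n) (p ^ n).
Proof.
case: n => [|n] uu; first exact: coprimen1.
have : coprime (residue u n.+1 * residue u^-1 n.+1) (p ^ n.+1).
  by rewrite -coprime_modl -residueM mulrV // residue1 coprime_modl coprime1n.
by rewrite coprimeMl => /andP[].
Qed.

(** Division by p loses one digit: v mod p^n is read from u mod p^(n+1). *)
Lemma padic_divp u : residue u 1 = 0%N -> exists v, u = p%:R * v.
Proof.
move=> u1; have p0 := prime_gt0 pr.
have fc n : (residue u n.+2 %/ p = residue u n.+1 %/ p %[mod p ^ n])%N.
  rewrite -(residueS u n.+1) {1}(divn_eq (residue u n.+2) (p ^ n.+1)).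
  by rewrite expnSr mulnA divnMDl // modnMDl.
exists (padic_of pr fc); apply: residueP => n.
rewrite residueM residue_nat residue_of modnMm mulnC divnK ?residueS //.
by rewrite /dvdn residue_mod_p u1.
Qed.

Lemma residue1_ratio u v : v \is a GRing.unit -> residue u 1 = residue v 1 ->
  exists w, u / v = 1 + p%:R * w.
Proof.
move=> vu uv; have [|w wE] := @padic_divp (u / v - 1).
  rewrite (residueD (u / v)) (_ : residue (u / v) 1 = residue (1 : Zp) 1).
    by rewrite -residueD subrr /residue /= mod0n.
  by rewrite residueM uv -residueM divrr.
by exists w; rewrite -wE addrC subrK.
Qed.

(** The cofactor 1 + w + ... + w^(p-2) of w - 1 in w^(p-1) - 1 is congruent to p - 1, that is, to -1
    mod p, hence a unit. *)
Lemma root_unity_1_mul_p v : (1 + p%:R * v) ^+ p.-1 = 1 -> 1 + p%:R * v = 1.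
Proof.
set w := 1 + _ => w1.
have /choice[y yE] i : exists y, w ^+ i = 1 + p%:R * y.
  elim: i => [|i [y IH]]; first by exists 0; rewrite mulr0 addr0.
  by exists (v + y + p%:R * v * y); rewrite exprS IH /w; ring.
have S : \sum_(i < p.-1) w ^+ i = - (1 + p%:R * (- 1 - \sum_(i < p.-1) y i)).
  under eq_bigr do rewrite yE.
  rewrite big_split /= sumr_const card_ord -mulr_sumr.
  have -> : p.-1%:R = p%:R - 1 :> Zp by rewrite -subn1 natrB // prime_gt0.
  by ring.
have := subrX1 w p.-1; rewrite w1 subrr S mulrN => /esym/eqP.
rewrite oppr_eq0 => /eqP /(congr1 (fun x => x / (1 + p%:R * (- 1 - \sum_(i < p.-1) y i)))).
by rewrite mulrK ?unit_1_mul_p // mul0r => /eqP; rewrite subr_eq0 => /eqP.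
Qed.

Lemma Frobenius_residue1 u k : residue (u ^+ (p ^ k)) 1 = residue u 1.
Proof.
elim: k => [|k IH]; first by rewrite expn0 expr1.
by rewrite expnSr exprM residueX IH expn1 fermat_little // residue_mod_p.
Qed.

(** The totient of p^n divides p^k (p - 1). Thus any limit of the u^(p^k) is a root of unity of
    order dividing p - 1. *)
Lemma Euler_residue u n k : u \is a GRing.unit -> (n <= k)%N ->
  residue ((u ^+ (p ^ k)) ^+ p.-1) n = residue (1 : Zp) n.
Proof.
case: n => [|n] uu nk; first by rewrite -residue_mod expn0 modn1 -residue_mod expn0 modn1.
rewrite -exprM residueX -(subnKC (ltnW nk)) expnD mulnAC mulnC.
have -> : (p ^ n * p.-1)%N = totient (p ^ n.+1) by rewrite totient_pfactor // mulnC.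
rewrite mulnC expnM -modnXm Euler_exp_totient ?coprime_unit //.
by rewrite modnXm exp1n residue1.
Qed.

End PadicArithmetic.

(** * The cyclotomic character and the subgroup Delta *)

Lemma open_krull (L : fieldType) (U : set (galgrp L)) : open U = krull_open U.
Proof. by []. Qed.

Section CyclotomicCharacter.
Variables (p : nat) (pr : prime p).
Local Notation Zp := (padic_int pr).
Local Notation Q_S := (QS p).
Local Notation QSv := (val : {rmorphism QS p -> algC}).
Local Notation G := (galgrp Q_S).

Lemma QS_prim_root n : exists z : Q_S, (p ^ n).-primitive_root z.
Proof.
have pn0 : (0 < p ^ n)%N by rewrite expn_gt0 prime_gt0.
have [z zP] := C_prim_root_exists pn0.
exists (InQS (mu_in_QS pr zP)).
by rewrite -(fmorph_primitive_root QSv).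
Qed.

Definition acts_by (g : G) (u : Zp) : Prop :=
  forall n (z : Q_S), z ^+ (p ^ n) = 1 -> g z = z ^+ residue u n.

Lemma acts_by_level (g : G) n : exists a, forall z : Q_S, z ^+ (p ^ n) = 1 -> g z = z ^+ a.
Proof.
have [z zP] := QS_prim_root n.
have [a ga] := gal_root_exp pr g (prim_expr_order zP).
exists a => y /(prim_rootP zP)[i ->].
by rewrite rmorphXn /= ga -!exprM mulnC.
Qed.

Lemma acts_by_ex (g : G) : exists u, acts_by g u.
Proof.
have /choice[a aP] := acts_by_level g.
have ac n : (a n.+1 = a n %[mod p ^ n])%N.
  have [z zP] := QS_prim_root n; apply/eqP.
  have zn := prim_expr_order zP; rewrite -(eq_prim_root_expr zP); apply/eqP.
  by rewrite -(aP n z zn) -(aP n.+1 z) // expnSr exprM zn expr1n.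
by exists (padic_of pr ac) => n z zn; rewrite residue_of expr_mod // -aP.
Qed.

(** A single primitive root determines the character mod p^n, whence its continuity for the Krull
    topology. *)
Lemma acts_by_residue (g h : G) u v n (z : Q_S) : (p ^ n).-primitive_root z ->
  acts_by g u -> acts_by h v -> g z = h z -> residue u n = residue v n.
Proof.
move=> zP gu hv e; have zn := prim_expr_order zP.
rewrite -(residue_mod u) -(residue_mod v); apply/eqP.
by rewrite -(eq_prim_root_expr zP) -(gu n z zn) e (hv n z zn).
Qed.

Lemma acts_by_uniq (g h : G) u v : acts_by g u -> acts_by h v ->
  (forall n (z : Q_S), z ^+ (p ^ n) = 1 -> g z = h z) -> u = v.
Proof.
move=> gu hv e; apply: residueP => n; have [z zP] := QS_prim_root n.
exact: acts_by_residue zP gu hv (e n z (prim_expr_order zP)).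
Qed.

Lemma cyclotomic_character_ex : exists c : character pr (Gamma p), is_cyclotomic c.
Proof.
have /choice[cyc cycP] := acts_by_ex.
pose f (c : Gamma p) : Zp := cyc (coset_repr c).
have fE g : f (toGamma p g) = cyc g.
  apply: acts_by_uniq (cycP _) (cycP _) _ => n z zn.
  have /(_ z) e : fixes_F_infty (g^-1 * coset_repr (toGamma p g))%g := coset_repr_of (H_S p) g.
  rewrite -[LHS](gal1E) -(mulgV g) gal_mulE -[X in g X]gal_mulE e //.
  by apply: gen_subfield_sub; exists n.
have f1 : f 1%g = 1.
  rewrite -(chom1 (toGamma p)) fE.
  apply: acts_by_uniq (cycP _) _ (fun _ _ _ => erefl) => n z zn.
  by rewrite residue1 expr_mod ?expr1.
have fM x y : f (x * y)%g = f x * f y.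
  have [g <-] := qmap_surj (toGamma p) x; have [h <-] := qmap_surj (toGamma p) y.
  rewrite -chomM !fE; apply: acts_by_uniq (cycP _) _ (fun _ _ _ => erefl) => n z zn.
  by rewrite gal_mulE residueM expr_mod // (cycP h n) // rmorphXn /= (cycP g n) // exprM.
have fc : continuous f.
  apply: residue_continuous => n a; apply: (qmap_open (q := toGamma p)).
  rewrite open_krull => g /= ga.
  have [z zP] := QS_prim_root n; exists [:: z] => h hg.
  rewrite /= fE -ga fE; apply: (acts_by_residue zP (cycP h) (cycP g)).
  by apply: hg; rewrite inE.
by exists (Character f1 fM fc) => g n z zn; rewrite /= fE; exact: cycP.
Qed.

Lemma chi_cyclotomic : is_cyclotomic (chi pr).
Proof. exact: (xgetPex _ cyclotomic_character_ex). Qed.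

Lemma fixes_F_infty_ratio (g h : G) : (forall n (z : Q_S), z ^+ (p ^ n) = 1 -> g z = h z) ->
  fixes_F_infty (g^-1 * h)%g.
Proof.
move=> gh; pose L : {pred Q_S} := fun x => g x == h x.
suff FL z : z \in @F_infty p -> z \in L.
  by move=> z /FL/eqP e; rewrite gal_mulE -e -gal_mulE mulVg.
apply: gen_subfield_min => [|t [n tn]]; last by apply/eqP; exact: gh tn.
split=> [|a b /eqP ha /eqP hb|a b /eqP ha /eqP hb]; rewrite unfold_in /L.
- by rewrite !rmorph1.
- by rewrite !rmorphB /= ha hb.
- by rewrite !fmorph_div /= ha hb.
Qed.

Lemma chi_inj : injective (chi pr).
Proof.
move=> x y; have [g <-] := qmap_surj (toGamma p) x; have [h <-] := qmap_surj (toGamma p) y.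
move=> e; apply/qcosetP; apply: fixes_F_infty_ratio => n t tn.
by rewrite (chi_cyclotomic h tn) -e -(chi_cyclotomic g tn).
Qed.

End CyclotomicCharacter.

(** * Pointwise ultralimits of automorphisms of Q_S *)

Section Limits.
Variable p : nat.
Local Notation Q_S := (QS p).
Local Notation QSv := (val : {rmorphism QS p -> algC}).
Local Notation G := (galgrp Q_S).

Lemma QS_conjugates_finite (x : Q_S) : exists s : seq Q_S, forall g : G, g x \in s.
Proof.
have [q [_ mq] qP] := minCpolyP (QSv x).
pose r := sval (closed_field_poly_normal (map_poly ratr q : {poly algC})).
have rP : map_poly ratr q =
    lead_coef (map_poly ratr q) *: \prod_(z <- r) ('X - z%:P) :> {poly algC}.
  by rewrite /r; case: closed_field_poly_normal.
exists (pmap insub r) => g; rewrite mem_pmap_sub.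
have : root (map_poly ratr q : {poly algC}) (QSv (g x)).
  have : root (map_poly ratr q) x.
    rewrite -(fmorph_root QSv) -map_poly_comp.
    rewrite (eq_map_poly (fmorph_rat _)) qP //; exact: dvdpp.
  rewrite -(fmorph_root g) -map_poly_comp (eq_map_poly (fmorph_rat _)).
  by rewrite -(fmorph_root QSv) -map_poly_comp (eq_map_poly (fmorph_rat _)).
rewrite rP rootZ ?root_prod_XsubC // lead_coef_eq0 map_poly_eq0.
exact: monic_neq0.
Qed.

Lemma ultra_pigeonhole (T : eqType) (U : set_system nat) (UU : UltraFilter U)
    (s : seq T) (f : nat -> T) :
  (forall k, f k \in s) -> exists y, U [set k | f k = y].
Proof.
move=> fs; have : U [set k | f k \in s].
  by apply: (filterS _ filterT) => k _; exact: fs.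
elim: s {fs} => [|y s IH].
  by move=> /filter_ex[k].
have [Uy|/= Uy] := in_ultra_setVsetC [set k | f k = y] UU; first by exists y.
move=> Uys; apply: IH; apply: (filterS _ (filterI Uy Uys)) => k /= [fy].
by rewrite inE => /orP[/eqP|].
Qed.

(** Orbits being finite, each h k x is constant for U-almost all k. An identity between finitely
    many limit values is checked at one common k; the limit of the inverses gives bijectivity. *)
Lemma gal_ultralimit (U : set_system nat) (UU : UltraFilter U) (h : nat -> G) :
  exists d : G, forall x, U [set k | h k x = d x].
Proof.
have lim (h' : nat -> G) : exists d : Q_S -> Q_S, forall x, U [set k | h' k x = d x].
  suff /choice[d] : forall x, exists y, U [set k | h' k x = y] by exists d.
  move=> x; have [s sP] := QS_conjugates_finite x.
  exact: (ultra_pigeonhole UU (s := s) (f := fun k => h' k x)).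
have [d dP] := lim h; have [d' d'P] := lim (fun k => (h k)^-1%g).
have daut : is_aut d.
  apply/asboolP; split.
  - move=> x y; have [k [/= <- [<- <-]]] :=
      filter_ex (filterI (dP (x - y)) (filterI (dP x) (dP y))).
    exact: rmorphB.
  - by have [k /= <-] := filter_ex (dP 1); exact: rmorph1.
  - move=> x y; have [k [/= <- [<- <-]]] :=
      filter_ex (filterI (dP (x * y)) (filterI (dP x) (dP y))).
    exact: rmorphM.
  exists d' => x.
    have [k [/= ex <-]] := filter_ex (filterI (dP x) (d'P (d x))).
    by rewrite -ex; exact: gal_funK.
  have [k [/= ex <-]] := filter_ex (filterI (d'P x) (dP (d' x))).
  by rewrite -ex; exact: gal_invK.
by exists (Defs.Gal daut).
Qed.

Lemma ultralimit_open (U : set_system nat) (UU : UltraFilter U) (h : nat -> G) (d : G)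
    (W : set (G_S p)) : (forall x, U [set k | h k x = d x]) -> open W -> W d ->
  U [set k | W (h k)].
Proof.
move=> dP; rewrite open_krull => oW Wd; have [s sP] := oW d Wd.
have : U [set k | {in s, h k =1 d}].
  elim: s {sP} => [|x s IH].
    have -> : [set k | {in [::], h k =1 d}] = setT by apply/seteqP; split.
    exact: filterT.
  apply: (filterS _ (filterI (dP x) IH)) => k /= [ex es] y.
  by rewrite inE => /orP[/eqP ->|/es].
by apply: (@filterS _ U) => k; exact: sP.
Qed.
End Limits.

Lemma charV p (pr : prime p) (K : preTopGroupType) (th : character pr K) x :
  th x^-1%g = (th x)^-1.
Proof.
by apply: (mulrI (char_unit th x)); rewrite divrr ?char_unit // -charM mulgV char1.
Qed.

(** * The decomposition of Gamma *)

Section DeltaGamma1.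
Variables (p : nat) (pr : prime p).
Local Notation Zp := (padic_int pr).
Local Notation G := (galgrp (QS p)).
Local Notation Gam := (Gamma p).

(* The lift is a limit of g^(p^k) along an ultrafilter, which exists because the
   orbits of G on Q_S are finite. *)
Lemma Teichmuller_lift (x : Gam) :
  exists d, Delta pr d /\ residue (chi pr d) 1 = residue (chi pr x) 1.
Proof.
have [g <-] := qmap_surj (toGamma p) x.
have [U [UU Uoo]] := @ultraFilterLemma nat (\oo)%classic _.
have [d dP] := gal_ultralimit UU (fun k => (g ^+ (p ^ k))%g : G).
have chiX k : chi pr (toGamma p (g ^+ k)%g) = chi pr (toGamma p g) ^+ k.
  elim: k => [|k IH]; first by rewrite expg0 (chom1 (toGamma p)) char1.
  by rewrite expgS chomM charM IH exprS.
have ap n : exists k, (n <= k)%N /\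
    residue (chi pr (toGamma p d)) n = residue (chi pr (toGamma p g) ^+ (p ^ k)) n.
  pose W : set (G_S p) := [set h | residue (char_comp (chi pr) (toGamma p) h) n =
    residue (chi pr (toGamma p d)) n].
  have oW : open W by apply: continuous_residue; exact: char_continuous.
  have UW := ultralimit_open UU dP oW erefl.
  have Un : U [set k | (n <= k)%N] by apply: Uoo; exists n.
  have [k [/= <- nk]] := filter_ex (filterI UW Un).
  by exists k; split=> //; rewrite -chiX.
exists (toGamma p d); split; last first.
  by have [k [_ ->]] := ap 1%N; exact: Frobenius_residue1.
apply: residueP => n; have [k [nk e]] := ap n.
rewrite (residue_exp _ e); apply: Euler_residue => //; exact: char_unit.
Qed.

Lemma Delta_Gamma1_split (x : Gam) : exists d, Delta pr d /\ in_Gamma1 pr (x * d^-1)%g.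
Proof.
have [d [dD e]] := Teichmuller_lift x; exists d; split=> //.
rewrite /in_Gamma1 /= charM charV.
by apply: residue1_ratio; rewrite ?char_unit.
Qed.

Lemma Delta_Gamma1_trivial (x : Gam) : Delta pr x -> in_Gamma1 pr x -> x = 1%g.
Proof.
move=> xD [v xv]; apply: (@chi_inj _ pr); rewrite char1 xv.
by apply: root_unity_1_mul_p; rewrite -xv.
Qed.

Lemma Delta1 : Delta pr 1%g.
Proof. by rewrite /Delta /= char1 expr1n. Qed.
Lemma DeltaM x y : Delta pr x -> Delta pr y -> Delta pr (x * y)%g.
Proof. by rewrite /Delta /= charM exprMn => -> ->; rewrite mulr1. Qed.
Lemma DeltaV x : Delta pr x -> Delta pr x^-1%g.
Proof.
rewrite /Delta /= => xD; have : chi pr (x * x^-1)%g ^+ p.-1 = 1 by rewrite mulgV char1 expr1n.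
by rewrite charM exprMn xD mul1r.
Qed.

Lemma Delta_residue_inj x y : Delta pr x -> Delta pr y ->
  residue (chi pr x) 1 = residue (chi pr y) 1 -> x = y.
Proof.
move=> xD yD e; apply: (mulIg y^-1%g); rewrite mulgV; apply: Delta_Gamma1_trivial.
  by apply: DeltaM => //; apply: DeltaV.
rewrite /in_Gamma1 /= charM charV.
by apply: residue1_ratio; rewrite ?char_unit.
Qed.

Lemma Delta_finite : finite_set (Delta pr).
Proof.
(* The default value p keeps the complement of Delta out of the preimage of the integers below p. *)
pose f x := if `[< Delta pr x >] then residue (chi pr x) 1 else p.
have DE x : (f x < p)%N -> Delta pr x.
  by rewrite /f; case: asboolP => // _; rewrite ltnn.
have -> : Delta pr = f @^-1` `I_p.
  apply/seteqP; split=> x /= xD; last exact: DE.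
  by rewrite /f asboolT // -residue_mod expn1 ltn_mod prime_gt0.
apply: finite_preimage (finite_II p) => x y /set_mem /= xf /set_mem /= yf.
have [xD yD] : Delta pr x /\ Delta pr y by split; apply: DE.
by rewrite /f !asboolT //; exact: Delta_residue_inj.
Qed.

Lemma mem_Delta x : (x \in fset_set (Delta pr)) = `[< Delta pr x >].
Proof. by rewrite in_fset_set ?unfold_in //; exact: Delta_finite. Qed.

(** Delta contains 1 and embeds in {1, ..., p - 1} by reduction mod p, so its size lies strictly
    between 0 and p. *)
Lemma Delta_size_coprime : coprime (size (fset_set (Delta pr))) p.
Proof.
set s := fset_set _.
have s0 : (0 < size s)%N.
  have : 1%g \in enum_fset s by rewrite mem_Delta; apply/asboolP; exact: Delta1.
  by case: (enum_fset s).
rewrite coprime_sym prime_coprime // gtnNdvd //.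
suff le : (size s <= p.-1)%N by apply: leq_ltn_trans le _; rewrite ltn_predL prime_gt0.
rewrite -(size_map (fun x => residue (chi pr x) 1)).
rewrite -[X in (_ <= X)%N](size_iota 1); apply: uniq_leq_size.
  rewrite map_inj_in_uniq ?fset_uniq // => x y.
  by rewrite !mem_Delta => /asboolP xD /asboolP yD; exact: Delta_residue_inj.
move=> _ /mapP[x _ ->]; rewrite mem_iota add1n (prednK (prime_gt0 pr)).
have -> : (residue (chi pr x) 1 < p)%N by rewrite -residue_mod expn1 ltn_mod prime_gt0.
rewrite andbT; have := coprime_unit 1 (char_unit (chi pr) x); rewrite lt0n; case: eqP => // ->.
by rewrite expn1 /coprime gcd0n => /eqP p1; move: pr; rewrite p1.
Qed.

End DeltaGamma1.

(** * Gamma-modules *)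

Section Projection.
Variables (p : nat) (pr : prime p).
Local Notation Gam := (Gamma p).

(** A [preTopGroupType] does not relate its law to its topology, so translations are treated in G: g
    h agrees with f h on s as soon as g agrees with f on h(s). *)
Lemma Gamma_mulr_open (U : set Gam) (a : Gam) : open U -> open [set x | U (x * a)%g].
Proof.
move=> oU; have [h <-] := qmap_surj (toGamma p) a; apply: (qmap_open (q := toGamma p)).
have /continuousP/(_ _ oU) oV := @chom_continuous _ _ (toGamma p).
have E g : U (toGamma p g * toGamma p h)%g = U (toGamma p (g * h)%g).
  by rewrite (chomM (toGamma p)).
rewrite open_krull => f; rewrite /preimage /mkset E => Uf.
move: oV; rewrite open_krull => /(_ _ Uf)[s sV].
exists [seq (h : galgrp _) x | x <- s] => g gf.
rewrite /preimage /mkset E; apply: sV => x xs.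
by rewrite !gal_mulE; apply: gf; exact: map_f.
Qed.

Lemma in_Gamma1E : in_Gamma1 pr = [set x | residue (chi pr x) 1 = (1 %% p ^ 1)%N].
Proof.
apply/seteqP; split=> x /=.
  case=> v ->; rewrite residueD residueM residue_nat expn1 modnn mul0n mod0n addn0.
  by rewrite residue1 expn1 modn_mod.
move=> e; have [||w] := @residue1_ratio p pr (chi pr x) 1; rewrite ?unitr1 ?residue1 //.
by rewrite divr1 => xw; exists w.
Qed.

Lemma Gamma1_open : open (in_Gamma1 pr).
Proof. by rewrite in_Gamma1E; apply: continuous_residue; exact: char_continuous. Qed.

Lemma Delta_Gamma1_uniq (x d e : Gam) : Delta pr d -> in_Gamma1 pr (x * d^-1)%g ->
  Delta pr e -> in_Gamma1 pr (x * e^-1)%g -> d = e.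
Proof.
move=> dD xd eD xe; apply: (mulIg e^-1%g); rewrite mulgV.
apply: (@Delta_Gamma1_trivial _ pr); first by apply: DeltaM => //; apply: DeltaV.
have := Gamma1_M (Gamma1_V xd) xe; rewrite invgM invgK.
by rewrite -mulgA mulKg.
Qed.

(** The map divides x by its Teichmueller lift. The preimage of an open set is a union of
    translates, by elements of Delta, of open subsets of Gamma_1. *)
Lemma Gamma1_retraction : exists pi : chom Gam (Gamma1 pr),
  (forall x, pi (Gamma1_incl pr x) = x) /\
  forall x, exists d, Delta pr d /\ x = (Gamma1_incl pr (pi x) * d)%g.
Proof.
have /choice[dl dlP] := @Delta_Gamma1_split p pr.
have dlE x d : Delta pr d -> in_Gamma1 pr (x * d^-1)%g -> dl x = d.
  by move=> dD xd; have [D1 D2] := dlP x; apply: (Delta_Gamma1_uniq D1 D2).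
pose pi x : Gamma1 pr := exist _ (x * (dl x)^-1)%g (mem_set (dlP x).2).
have piM x y : pi (x * y)%g = (pi x * pi y)%g.
  apply: val_inj => /=.
  have e : ((x * y) * (dl x * dl y)^-1 = (x * (dl x)^-1) * (y * (dl y)^-1))%g.
    rewrite invgM -!mulgA; congr (_ * _)%g.
    by rewrite [RHS]Gamma_comm // -mulgA.
  rewrite (dlE (x * y)%g (dl x * dl y)%g); first exact: e.
    by apply: DeltaM; apply: (dlP _).1.
  by rewrite e; apply: Gamma1_M; apply: (dlP _).2.
have pic : continuous pi.
  apply: continuous_comp_initial; apply/continuousP => W oW.
  have -> : (val \o pi) @^-1` W = \bigcup_(d in Delta pr)
      [set x | (in_Gamma1 pr `&` W) (x * d^-1)%g].
    apply/seteqP; split=> [x /= Wx | x [d dD [xd Wxd]]].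
      by exists (dl x); [exact: (dlP x).1 | split; [exact: (dlP x).2 | ]].
    by rewrite /= (dlE x d).
  apply: bigcup_open => d _; apply: Gamma_mulr_open; apply: openI oW.
  exact: Gamma1_open.
exists (CHom piM pic); split=> x /=.
  apply: val_inj => /=; rewrite (dlE _ 1%g) ?invg1 ?mulg1 //; first exact: Delta1.
  exact: set_mem (valP x).
by exists (dl x); split; [exact: (dlP x).1 | rewrite mulgVK].
Qed.

End Projection.

Section RestrictionInjective.
Variables (p : nat) (K L : preTopGroupType) (i : chom L K) (pi : chom K L).

(** The second hypothesis says that M is inflated from L along pi. An extension problem over L is
    inflated to K, solved there and restricted back along i. *)
Lemma injective_res (M : dmod p K) : (forall x, pi (i x) = x) ->
    (forall k (x : M), dm_act k x = dm_act (i (pi k)) x) ->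
  injective_dmod M -> injective_dmod (res_dmod i M).
Proof.
move=> piK Mpi injM A B j f ij.
have fA k (x : res_dmod pi A) : f (dm_act k x) = dm_act (d := M) k (f x).
  by rewrite Mpi; exact: (dh_act f (pi k) x).
have [u uE] := injM (res_dmod pi A) (res_dmod pi B) (res_hom pi j)
  (@DHom _ _ (res_dmod pi A) M f (dhB f) fA) ij.
have uA l (x : B) : u (dm_act l x) = dm_act (d := res_dmod i M) l (u x).
  by rewrite -{1}(piK l); exact: (dh_act u (i l) x).
by exists (@DHom _ _ B (res_dmod i M) u (dhB u) uA).
Qed.

End RestrictionInjective.

(** * The eigenspaces of Delta *)

Section Eigenspace.
Variables (p : nat) (pr : prime p).
Local Notation Gam := (Gamma p).
Local Notation Delt := (fset_set (Delta pr)).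
Variables (th : character pr Gam) (w : Gam -> padic_int pr).
Hypothesis wE : forall d, Delta pr d -> w d = th d.
Local Notation a := (p.-1%:R^-1 : padic_int pr).
Local Notation c := (a * (size Delt)%:R).

Section Module.
Variable M : dmod p Gam.
Local Notation act := (@padic_act p pr _ (@dm_primary _ _ M)).
Local Notation e := (gring_act a Delt w (M := M)).

Lemma padic_act_nat n (x : M) : act n%:R x = x *+ n.
Proof.
have [k xk] := @dm_primary _ _ M x.
by rewrite (padic_actE _ _ xk) residue_nat mulrn_modn.
Qed.

Lemma padic_act_comm u v (x : M) : act u (act v x) = act v (act u x).
Proof. by rewrite -!padic_actM mulrC. Qed.

Lemma padic_act_dm u g (x : M) : act u (dm_act g x) = dm_act g (act u x).
Proof. by rewrite (padic_act_additive _ (@dm_primary _ _ M) (dm_act (d := M) g)). Qed.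

Lemma unit_c : c \is a GRing.unit.
Proof.
rewrite unitrM unitrV !unit_nat ?Delta_size_coprime //.
have p1 := prime_gt1 pr.
by rewrite coprime_sym prime_coprime // gtnNdvd //; lia.
Qed.

Lemma gring_actE x : e x = act a (\sum_(d <- Delt) tw_act th d x).
Proof.
rewrite /gring_act; congr act; apply: eq_big_seq => d.
by rewrite mem_Delta => /asboolP dD; rewrite /tw_act wE.
Qed.

Lemma gring_act_fixed x : (forall d, Delta pr d -> tw_act th d x = x) -> e x = act c x.
Proof.
move=> xD; rewrite gring_actE (eq_big_seq (fun _ => x)).
  by rewrite big_const_seq count_predT iter_addr_0 padic_actM padic_act_nat.
by move=> d; rewrite mem_Delta => /asboolP; exact: xD.
Qed.

Lemma tw_act_gring d x : Delta pr d -> tw_act th d (e x) = e x.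
Proof.
move=> dD; rewrite gring_actE {1}/tw_act -padic_act_dm padic_act_comm; congr act.
rewrite (raddf_sum (dm_act (d := M) d)) padic_act_sum.
under eq_bigr do rewrite -[padic_act _ _ _]/(tw_act th d _) -tw_actM.
rewrite -(big_map (fun d' => d * d')%g predT (fun d' => tw_act th d' x)).
apply: perm_big; apply: uniq_perm; rewrite ?map_inj_uniq ?fset_uniq //.
  exact: mulgI.
move=> y; rewrite mem_Delta; apply/mapP/asboolP => [[z]|yD].
  by rewrite mem_Delta => /asboolP zD ->; exact: DeltaM.
exists (d^-1 * y)%g; last by rewrite mulVKg.
by rewrite mem_Delta; apply/asboolP/DeltaM => //; exact: DeltaV.
Qed.


(** Averaging over Delta produces invariants of the twist; conversely e multiplies an invariant x by
    the unit c, so that x = e (c^-1 x). *)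
Lemma gring_predP (x : M) : x \in @gring_pred p pr _ a Delt w M <->
  forall d, Delta pr d -> tw_act th d x = x.
Proof.
split=> [/asboolP[y ->] d|xD]; first exact: tw_act_gring.
apply/asboolP; exists (act c^-1 x); rewrite gring_act_fixed.
  by rewrite -padic_actM mulrV ?unit_c // padic_act1.
by move=> d dD; rewrite /tw_act -padic_act_dm padic_act_comm -/(tw_act th d x) xD.
Qed.
End Module.

(** The image of e is a direct summand of M, with projection c^-1 e. The scalar is put on f: if u
    extends c^-1 f to B, then e u extends f. *)
Lemma injective_gring (M : dmod p Gam) : injective_dmod M ->
  injective_dmod (gring_img (@Gamma_comm p pr) a Delt w M).
Proof.
move=> injM A B i f ii.
pose P := gring_img (@Gamma_comm p pr) a Delt w M.
pose act := @padic_act p pr _ (@dm_primary _ _ M).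
have gB : {morph (fun x => act c^-1 (val (f x))) : x y / x - y}.
  by move=> x y; rewrite dhB /= /act padic_actD padic_actN.
have gA g x : act c^-1 (val (f (dm_act g x))) = dm_act g (act c^-1 (val (f x))).
  by rewrite dh_act /= /act padic_act_dm.
have [u uE] := injM _ _ i (@DHom _ _ A M _ gB gA) ii.
have eP x : gring_act a Delt w (u x) \in @gring_pred p pr _ a Delt w M.
  by apply/asboolP; exists (u x).
pose v (x : B) : P := Sub (gring_act a Delt w (u x)) (eP x).
have vB : {morph v : x y / x - y}.
  by move=> x y; apply: val_inj; rewrite /= dhB gring_actB.
have vA g x : v (dm_act g x) = dm_act g (v x).
  apply: val_inj; rewrite /= dh_act.
  have E h z : dm_act (d := M) g (dm_act h z) = dm_act h (dm_act g z).
    by rewrite -!dm_actM Gamma_comm.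
  by rewrite -(gring_act_hom a Delt w (@DHom _ _ M M (dm_act g) (dm_actB g) E)).
exists (DHom vB vA) => x; apply: val_inj => /=; rewrite uE /=.
have /gring_predP fx : val (f x) \in @gring_pred p pr _ a Delt w M := valP (f x).
rewrite gring_act_fixed /act -?padic_actM ?mulrV ?unit_c ?padic_act1 // => d dD.
by rewrite /tw_act -padic_act_dm padic_act_comm -/(tw_act th d _) fx.
Qed.

End Eigenspace.

Lemma sub_zmod_padic_act p (pr : prime p) (M : zmodType) (S : {pred M}) (Sc : zmod_closed S)
    (Mp : p_primary p M) (Np : p_primary p (sub_zmod Sc)) (u : padic_int pr) (x : sub_zmod Sc) :
  val (padic_act Np u x) = padic_act Mp u (val x).
Proof. exact: (padic_act_additive Np Mp (val : {additive sub_zmod Sc -> M})). Qed.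

(** * Invariants under G computed in stages *)

Section InvariantsInStages.
Variables (p : nat) (pr : prime p).
Local Notation Gam := (Gamma p).
Variables (th : character pr Gam) (w : Gam -> padic_int pr).
Hypothesis wE : forall d, Delta pr d -> w d = th d.
Local Notation a := (p.-1%:R^-1 : padic_int pr).
Local Notation Delt := (fset_set (Delta pr)).
Local Notation thG := (char_comp th (toGamma p)).

Definition gring_twist (M : dmod p Gam) : dmod p Gam :=
  twist_dmod th (gring_img (@Gamma_comm p pr) a Delt w M).

Lemma gring_twist_actE (M : dmod p Gam) (pi : chom Gam (Gamma1 pr)) :
  (forall x, exists d, Delta pr d /\ x = (Gamma1_incl pr (pi x) * d)%g) ->
  forall k (x : gring_twist M), dm_act k x = dm_act (Gamma1_incl pr (pi k)) x.
Proof.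
move=> piD k x; have [d [dD {1}->]] := piD k; rewrite dm_actM; congr dm_act.
apply: val_inj; apply: etrans (sub_zmod_padic_act (@dm_primary _ _ M) _ _ _) _.
have /(gring_predP wE) fx := valP (x : sub_zmod (gring_closed a Delt w M)).
exact: fx.
Qed.

Lemma injective_res_gring_twist (M : dmod p Gam) : injective_dmod M ->
  injective_dmod (res_dmod (Gamma1_incl pr) (gring_twist M)).
Proof.
move=> injM; have [pi [piK piD]] := Gamma1_retraction pr.
apply: injective_res piK (gring_twist_actE piD) _.
apply: injective_twist; exact: injective_gring wE _ injM.
Qed.

Section Module.
Variable N : dmod p (G_S p).
Local Notation M := (inv_dmod (toGamma p) N).
Local Notation C := (res_dmod (Gamma1_incl pr) (gring_twist M)).
Local Notation src := (inv_dmod (to_unit (G_S p)) (twist_dmod thG N)).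
Local Notation tgt := (inv_dmod (to_unit (Gamma1 pr)) C).

Lemma G_fixed (x : src) (g : G_S p) :
  padic_act (@dm_primary _ _ N) (th (toGamma p g)) (dm_act (d := N) g (val x)) = val x.
Proof. have /asboolP/(_ g erefl) h := valP x; exact: h. Qed.

(** The character is pulled back from Gamma, hence equal to 1 on H. *)
Lemma G_inv (x : src) : (val x : N) \in inv_pred (toGamma p) N.
Proof.
apply/asboolP => g g1; have := G_fixed x g.
by rewrite g1 char1 padic_act1.
Qed.

Definition stage_H (x : src) : M := inv_elt (G_inv x).

Lemma stage_H_fixed (x : src) (q : Gam) : tw_act th q (stage_H x) = stage_H x.
Proof.
have [g <-] := qmap_surj (toGamma p) q; apply: val_inj.
apply: etrans (sub_zmod_padic_act (@dm_primary _ _ N) _ _ _) _.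
by rewrite (inv_actE g (stage_H x)) G_fixed.
Qed.

Lemma stage_H_gring (x : src) : stage_H x \in @gring_pred p pr _ a Delt w M.
Proof. by apply/(gring_predP wE) => d _; exact: stage_H_fixed. Qed.

Definition stage_Delta (x : src) : C :=
  (Sub (stage_H x) (stage_H_gring x) : sub_zmod (gring_closed a Delt w M)).

Lemma stage_Delta_inv (x : src) : stage_Delta x \in inv_pred (to_unit (Gamma1 pr)) C.
Proof.
apply/asboolP => g _; apply: val_inj.
apply: etrans (sub_zmod_padic_act (@dm_primary _ _ M) _ _ _) _; exact: stage_H_fixed.
Qed.

Definition stage_Gamma1 (x : src) : tgt := inv_elt (stage_Delta_inv x).

Fact stage_Gamma1B : {morph stage_Gamma1 : x y / x - y}.
Proof. by move=> x y; do 3!apply: val_inj. Qed.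

Fact stage_Gamma1_act g (x : src) : stage_Gamma1 (dm_act g x) = dm_act g (stage_Gamma1 x).
Proof.
have -> : g = 1%g by case: g.
exact: etrans (congr1 stage_Gamma1 (dm_act1 x)) (esym (dm_act1 (stage_Gamma1 x))).
Qed.

(** An element of N(th)^G is seen in N^H, then in the image of e, then among its Gamma_1-invariants.
    The underlying element of N is unchanged, hence the three nested [val]. *)
Definition stages_hom : dhom src tgt := DHom stage_Gamma1B stage_Gamma1_act.

Lemma stages_inj : injective stages_hom.
Proof.
move=> x y /(congr1 (fun z => val (val (val z)))) e; exact: val_inj.
Qed.

Lemma stages_surj (y : tgt) : exists x, stages_hom x = y.
Proof.
pose y2 : C := val y; pose y1 : M := val (y2 : sub_zmod (gring_closed a Delt w M)).
have y1D d : Delta pr d -> tw_act th d y1 = y1.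
  by have /(gring_predP wE) h := valP (y2 : sub_zmod (gring_closed a Delt w M)); exact: h.
have y1G (q : Gamma1 pr) : tw_act th (Gamma1_incl pr q) y1 = y1.
  have /asboolP/(_ q erefl)/(congr1 val) h := valP y; apply: etrans _ h.
  exact/esym/(sub_zmod_padic_act (@dm_primary _ _ M)).
have [pi [_ piD]] := Gamma1_retraction pr.
have y1F q : tw_act th q y1 = y1.
  by have [d [dD ->]] := piD q; rewrite tw_actM y1D.
have h : (val y1 : twist_dmod thG N) \in inv_pred (to_unit (G_S p)) (twist_dmod thG N).
  apply/asboolP => g _; have /(congr1 val) := y1F (toGamma p g); apply: etrans.
  apply: esym; apply: etrans (sub_zmod_padic_act (@dm_primary _ _ N) _ _ _) _.
  by rewrite (inv_actE g y1).
by exists (inv_elt h); do 3!apply: val_inj.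
Qed.
End Module.

Section Complexes.
Variable I : complex p (G_S p).
Local Notation src n := (inv_dmod (to_unit (G_S p)) (twist_dmod thG (I n))).

Definition gring_twistC (X : complex p Gam) : complex p (Gamma1 pr) :=
  resC (Gamma1_incl pr) (twistC th (gringC (@Gamma_comm p pr) a Delt w X)).

Definition stages_map : chain_map (invC (to_unit (G_S p)) (twistC thG I))
  (invC (to_unit (Gamma1 pr)) (gring_twistC (invC (toGamma p) I))).
Proof.
exists (fun n => stages_hom (I n)) => n x.
by do 3!apply: val_inj.
Defined.

Lemma stages_quasi_iso : quasi_iso stages_map.
Proof. by apply: quasi_iso_bij => n; [exact: stages_inj | exact: stages_surj]. Qed.

Lemma gring_twist_dplus (X : complex p Gam) : dplus_object X -> dplus_object (gring_twistC X).
Proof.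
move=> [[n0 X0] iX]; split=> [|n]; last exact: injective_res_gring_twist.
by exists n0 => n /X0 h x; apply: val_inj; exact: h.
Qed.
End Complexes.

Lemma RGamma_descent (A : zmodType) (Ap : p_primary p A) (XA : complex p Gam)
    (L R : complex p unit) :
  is_RGamma (toGamma p) (in_degree0 (triv_dmod (G_S p) Ap)) XA ->
  is_RGamma (to_unit (G_S p))
    (in_degree0 (twist_dmod thG (triv_dmod (G_S p) Ap))) L ->
  is_RGamma (to_unit (Gamma1 pr)) (gring_twistC XA) R ->
  dplus_equiv L R.
Proof.
move=> [I [[dI [f qf]] ->]] [J [[dJ [g qg]] ->]] [K [[dK [k qk]] ->]].
have qtf := quasi_iso_comp (twist_deg0_quasi_iso thG _) (twist_quasi_iso thG qf).
have dtI := twist_dplus thG dI.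
(* J and I(theta) both resolve A(theta), the latter through [twist_deg0]. *)
have [h qh] := resolution_comparison qg qtf dtI.
have dC := gring_twist_dplus (inv_dplus (toGamma p) dI).
have q1 := inv_quasi_iso (to_unit _) dJ dtI qh.
have q2 := inv_quasi_iso (to_unit _) dC dK qk.
apply: quasi_iso_dplus_equiv (inv_dplus _ dK) _.
exact: quasi_iso_comp (quasi_iso_comp q1 (stages_quasi_iso I)) q2.
Qed.

End InvariantsInStages.

(** The condition 1 < N ensures that ['Z_N] has modulus N. A negative m is handled by uniqueness of
    inverses. *)
Lemma exp_Zp_int (R : comUnitRingType) (u : R) (N : nat) (m : int) : (1 < N)%N -> u ^+ N = 1 ->
  u ^ m = u ^+ (m%:~R : 'Z_N).
Proof.
move=> N1 uN.
have uu : u \is a GRing.unit.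
  by apply/unitrP; exists (u ^+ N.-1); rewrite -exprSr -exprS prednK ?(ltnW N1).
have E k : u ^+ (k%:R : 'Z_N) = u ^+ k by rewrite val_Zp_nat // expr_mod.
have D (x y : 'Z_N) : u ^+ (x + y)%R = u ^+ x * u ^+ y.
  rewrite -exprD -[RHS](expr_mod _ uN); congr (_ ^+ _).
  change ((x + y) %% (Zp_trunc N).+2 = (x + y) %% N)%N.
  by move: (nat_of_ord x) (nat_of_ord y) => i j; rewrite Zp_cast.
case: m => k; first by rewrite -pmulrn E.
rewrite NegzE mulrNz -pmulrn -exprnN.
apply: (mulIr (unitrX k.+1 uu)); rewrite mulVr ?unitrX // -(E k.+1) -D addNr.
by [].
Qed.

Theorem corollary2p13 (p : nat) (pr : prime p) (p_odd : odd p)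
    (A : zmodType) (A_primary : p_primary p A) :
  (forall (theta : character pr (Gamma p)) (m : 'Z_(p.-1)),
     (forall d, Delta pr d -> theta d = chi pr d ^+ m) ->
     forall (XA : complex p (Gamma p)) (L R : complex p unit),
       is_RGamma (toGamma p)
         (in_degree0 (triv_dmod (G_S p) A_primary)) XA ->
       is_RGamma (to_unit (G_S p))
         (in_degree0 (twist_dmod (char_comp theta (toGamma p))
                        (triv_dmod (G_S p) A_primary))) L ->
       is_RGamma (to_unit (Gamma1 pr))
         (resC (Gamma1_incl pr) (twistC theta (e_ pr (- m) XA))) R ->
       dplus_equiv L R) /\
  (forall (m : int)
     (XA : complex p (Gamma p)) (L R : complex p unit),
       is_RGamma (toGamma p)
         (in_degree0 (triv_dmod (G_S p) A_primary)) XA ->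
       is_RGamma (to_unit (G_S p))
         (in_degree0 (twist_dmod (char_comp (char_exp (chi pr) m) (toGamma p))
                        (triv_dmod (G_S p) A_primary))) L ->
       is_RGamma (to_unit (Gamma1 pr))
         (resC (Gamma1_incl pr)
            (twistC (char_exp (chi pr) m)
               (e_ pr (- (m%:~R : 'Z_(p.-1))) XA))) R ->
       dplus_equiv L R).
Proof.
split=> [theta m thE XA L R|m XA L R]; apply: RGamma_descent => d dD.
  by rewrite opprK thE.
rewrite opprK; apply/esym/exp_Zp_int => //.
(* Oddness of p gives 1 < p - 1. *)
by have := prime_gt1 pr; lia.
Qed.
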